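(* Assume the Continuum Hypothesis (CH). Then there exists a WLD Banach space $X$ such that $(B_{X^*},w^* )$ fails property (M) and the injective tensor product $X\widehat{\otimes}_\varepsilon X$ does not have property (C). Consequently, under CH, the property of having $w^*$-angelic dual ball is not preserved by the injective tensor product: for such $X$, $(B_{X^*},w^* )$ is angelic (i.e. Fréchet-Urysohn) while $(B_{(X\widehat{\otimes}_\varepsilon X)^*},w^* )$ is not.
   Context: All Banach spaces are real; an operator is a continuous linear map. $(B_{X^*},w^* )$ is the closed unit ball of $X^*$ with the weak$^*$ topology. A topological space is Fréchet-Urysohn if every point in the closure of a subset is the limit of a sequence in that subset. A Banach space $Z$ has (Corson's) property (C) if every family of convex closed subsets of $Z$ with empty intersection has a countable subfamily with empty intersection. For a non-empty set $\Gamma$, $\ell_\infty^c(\Gamma)$ is the subspace of $\ell_\infty(\Gamma)$ consisting of all bounded functions $f:\Gamma\to\mathbb{R}$ with countable support, and $\tau_p(\Gamma)$ is the topology of pointwise convergence on $\Gamma$. A Banach space $X$ is weakly Lindelöf determined (WLD) if there exist a non-empty set $\Gamma$ and an injective operator $\Phi:X^*\to\ell_\infty^c(\Gamma)$ which is $w^*$-to-$\tau_p(\Gamma)$ continuous. Equivalently, $(B_{X^*},w^* )$ is a Corson compact space, i.e. it embeds homeomorphically into $[-1,1]^\Gamma\cap\ell_\infty^c(\Gamma)$ with $\tau_p(\Gamma)$ for some $\Gamma$. A Corson compact space $K$ has property (M) if every regular Borel probability measure on $K$ has separable support. *)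

(* Defs.v *)
From HB Require Import structures.
From mathcomp Require Import all_boot all_order all_algebra.
From mathcomp Require Import all_classical all_reals all_analysis.

Set Implicit Arguments.
Unset Strict Implicit.
Unset Printing Implicit Defensive.

Import Order.TTheory GRing.Theory Num.Theory.
Import numFieldNormedType.Exports.

Local Open Scope classical_set_scope.
Local Open Scope card_scope.
Local Open Scope ring_scope.

(* Every set of reals is countable or equipotent with the real line. *)
Definition continuum_hypothesis (R : realType) : Prop :=
  forall A : set R, countable A \/ A #= [set: R].

Section SubNormed.
Context {R : realType} {V : normedModType R}.

Record subnormed (S : submodClosed V) :=
  SubNormed { subnormed_val : V; _ : subnormed_val \in S }.

Variable S : submodClosed V.

HB.instance Definition _ := [isSub for @subnormed_val S].
HB.instance Definition _ := [Choice of subnormed S by <:].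
HB.instance Definition _ := [SubChoice_isSubLmodule of subnormed S by <:].

Let nrm (x : subnormed S) : R := `|val x|.

Let nrmD x y : nrm (x + y) <= nrm x + nrm y.
Proof. exact: ler_normD. Qed.

Let nrmZ (l : R) x : nrm (l *: x) = `|l| * nrm x.
Proof. exact: normrZ. Qed.

Let nrm_eq0 x : nrm x = 0 -> x = 0.
Proof. by move=> /eqP; rewrite normr_eq0 => /eqP x0; exact: val_inj. Qed.

HB.instance Definition _ :=
  Lmodule_isNormed.Build R (subnormed S) nrmD nrmZ nrm_eq0.

Lemma subnormed_normE (x : subnormed S) : `|x| = `|val x|.
Proof. by []. Qed.

End SubNormed.

Section Linf.
Variables (R : realType) (G : Type).

Definition linf_pred : {pred G -> R^o} :=
  fun f => `[< exists M : R, forall g, `|f g| <= M >].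

Record linf := Linf { linf_val :> G -> R^o; _ : linf_val \in linf_pred }.

Fact linf_submod_closed : submod_closed linf_pred.
Proof.
split; first by apply/asboolP; exists 0 => g; rewrite normr0.
move=> a u v /asboolP[M uM] /asboolP[N vN]; apply/asboolP.
exists (`|a| * M + N) => g; rewrite (le_trans (ler_normD _ _))// lerD//.
by rewrite normrZ ler_wpM2l.
Qed.

HB.instance Definition _ :=
  GRing.isSubmodClosed.Build R (G -> R^o) linf_pred linf_submod_closed.
HB.instance Definition _ := [isSub for linf_val].
HB.instance Definition _ := [Choice of linf by <:].
HB.instance Definition _ := [SubChoice_isSubLmodule of linf by <:].

(* When [G] is empty the supremum is [sup set0 = 0]. *)
Definition linf_norm (f : linf) : R := sup [set `|f g| | g in [set: G]].

Lemma linf_has_ubound (f : linf) : has_ubound [set `|f g| | g in [set: G]].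
Proof.
case: f => f /= /asboolP[M fM]; exists M => _ [g _ <-]; exact: fM.
Qed.

Lemma linf_norm_ub (f : linf) g : `|f g| <= linf_norm f.
Proof. by apply: ub_le_sup; [exact: linf_has_ubound|exists g]. Qed.

Lemma linf_norm_le (f : linf) (M : R) :
  0 <= M -> (forall g, `|f g| <= M) -> linf_norm f <= M.
Proof.
move=> M0 fM; rewrite /linf_norm.
have [->|/set0P ne] := eqVneq [set `|f g| | g in [set: G]] set0.
  by rewrite sup0.
by apply: ge_sup => // _ [g _ <-].
Qed.

Let nrm_ge0 f : 0 <= linf_norm f.
Proof.
rewrite /linf_norm.
have [->|/set0P[_ [g _ _]]] := eqVneq [set `|f g| | g in [set: G]] set0.
  by rewrite sup0.
exact: le_trans (linf_norm_ub f g).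
Qed.

Let nrmD x y : linf_norm (x + y) <= linf_norm x + linf_norm y.
Proof.
apply: linf_norm_le => [|g]; first exact: addr_ge0.
by rewrite (le_trans (ler_normD _ _))// lerD ?linf_norm_ub.
Qed.

Let nrm_eq0 x : linf_norm x = 0 -> x = 0.
Proof.
move=> x0; apply: val_inj; apply/funext => g.
by apply/eqP; rewrite -normr_le0 -x0 linf_norm_ub.
Qed.

Let nrmZ_le (l : R) x : linf_norm (l *: x) <= `|l| * linf_norm x.
Proof.
apply: linf_norm_le => [|g]; first exact: mulr_ge0.
by rewrite [X in `|X|]/(l *: (x g)) normrZ ler_wpM2l ?linf_norm_ub.
Qed.

Let nrmZ (l : R) x : linf_norm (l *: x) = `|l| * linf_norm x.
Proof.
apply/eqP; rewrite eq_le nrmZ_le/=.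
have [->|l0] := eqVneq l 0; first by rewrite normr0 mul0r.
rewrite -ler_pdivlMl ?normr_gt0// -normfV.
by apply: le_trans (nrmZ_le _ _); rewrite scalerA mulVf// scale1r.
Qed.

HB.instance Definition _ :=
  Lmodule_isNormed.Build R linf nrmD nrmZ nrm_eq0.

Lemma linf_normE (f : linf) : `|f| = sup [set `|f g| | g in [set: G]].
Proof. by []. Qed.

End Linf.

Section LinfComplete.
Variables (R : realType) (G : Type).

Let linf_complete (F : set_system (linf R G)) :
  ProperFilter F -> cauchy F -> cvg F.
Proof.
move=> FF /cauchyP FC.
have Fg g : cvg ((fun f : linf R G => f g : R^o) @ F).
  apply: R_complete; apply/cauchyP => e e0.
  have [x Fx] := FC _ e0; exists (x g).
  suff : F [set f : linf R G | ball (x g : R^o) e (f g)] by [].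

  apply: filterS Fx => f /=.
  rewrite -!ball_normE /ball_/= => xf; apply: le_lt_trans xf.
  exact: (linf_norm_ub (x - f) g).
pose l g : R^o := lim ((fun f : linf R G => f g : R^o) @ F).
have lP e (x : linf R G) : F (ball x e) -> forall g, `|x g - l g| <= e.
  move=> Fx g.
  have cl : (fun f : linf R G => x g - f g : R^o) @ F --> x g - l g.
    by apply: cvgB; [exact: cvg_cst|exact: Fg].
  have nl : (fun f : linf R G => `|x g - f g| : R^o) @ F --> `|x g - l g|.
    exact: cvg_norm.
  apply: (cvgr_to_le nl).
  suff : F [set f : linf R G | `|x g - f g| <= e] by [].
  apply: filterS Fx => f; rewrite -ball_normE /ball_/= => xf.
  by apply: le_trans (ltW xf); exact: (linf_norm_ub (x - f) g).
have lb : l \in @linf_pred R G.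
  have [x Fx] := FC 1 ltr01; apply/asboolP; exists (1 + linf_norm x) => g.
  rewrite -[l g](subrK (x g)) (le_trans (ler_normD _ _))// lerD//.
    by rewrite distrC lP.
  exact: linf_norm_ub.
apply/cvg_ex; exists (Linf lb); apply/cvgrPdist_le => e e0.
have e20 : 0 < e / 2 by rewrite divr_gt0.
have [x Fx] := FC _ e20; near=> f.
apply: linf_norm_le => [|g]; first exact: ltW.
have xf : ball x (e / 2) f by near: f.
rewrite -[X in `|X|]/(l g - f g) -(subrKA (x g)) [leRHS]splitr.
rewrite (le_trans (ler_normD _ _))// lerD//; first by rewrite distrC lP.
move: xf; rewrite -ball_normE /ball_/= => xf.
by apply: le_trans (ltW xf); exact: (linf_norm_ub (x - f) g).
Unshelve. all: by end_near. Qed.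

HB.instance Definition _ := Uniform_isComplete.Build (linf R G) linf_complete.

End LinfComplete.

Lemma subnormed_complete (R : realType) (V : completeNormedModType R)
    (S : submodClosed V) : closed [set x | x \in S] ->
  forall F : set_system (subnormed S), ProperFilter F -> cauchy F -> cvg F.
Proof.
move=> Scl F FF /cauchyP FC.
have Fv : cvg ((val : subnormed S -> V) @ F).
  apply: cauchy_cvg; apply: cauchy_exP => e e0.
  have [x Fx] := FC _ e0; exists (val x).
  suff : F [set f | ball (val x) e (val f)] by [].

  by apply: filterS Fx => f; rewrite -!ball_normE.
have Sl : lim ((val : subnormed S -> V) @ F) \in S.
  apply: (@closed_cvg _ _ F FF (val : subnormed S -> V) _ Scl _ _ Fv).
  by apply: nearW => x; exact: valP.
apply/cvg_ex; exists (SubNormed Sl); apply/cvgrPdist_lt => e e0.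
by move/cvgrPdist_lt : Fv => /(_ _ e0).
Qed.

Section LinfC.
Variables (R : realType) (G : Type).

Definition linf_c_pred : {pred linf R G} :=
  fun f => `[< countable [set g | f g != 0] >].

Fact linf_c_submod_closed : submod_closed linf_c_pred.
Proof.
split.
  apply/asboolP; rewrite (_ : [set _ | _] = set0)//.
  by apply/seteqP; split => // g /=; rewrite eqxx.
move=> a u v /asboolP cu /asboolP cv; apply/asboolP.
apply: (sub_countable (B := [set g | u g != 0] `|` [set g | v g != 0])).
  apply: subset_card_le => g /=.
  rewrite -[X in X != 0]/(a *: u g + v g) => uv.
  apply/orP; apply: contraNT uv; rewrite negb_or !negbK => /andP[/eqP-> /eqP->].
  by rewrite scaler0 addr0.
by rewrite -bigcup2E; apply: bigcup_countable => // -[|[|n]].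
Qed.

HB.instance Definition _ :=
  GRing.isSubmodClosed.Build R (linf R G) linf_c_pred linf_c_submod_closed.

Definition linf_c := subnormed linf_c_pred.

HB.instance Definition _ := NormedModule.on linf_c.

End LinfC.

Section Dual.
Variables (R : realType) (X : normedModType R).

Definition dual_pred : {pred X -> R^o} :=
  fun f => `[< linear f /\ continuous f >].

Record dual := Dual { dual_val :> X -> R^o; _ : dual_val \in dual_pred }.

Fact dual_submod_closed : submod_closed dual_pred.
Proof.
split.
  apply/asboolP; split; last exact: cst_continuous.
  by move=> a x y; rewrite -[RHS]/(a *: (0 : R^o) + 0) scaler0 addr0.
move=> a u v /asboolP[ul uc] /asboolP[vl vc]; apply/asboolP; split.
  move=> b x y; rewrite -[LHS]/(a *: u (b *: x + y) + v (b *: x + y)).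
  rewrite -[RHS]/(b *: (a *: u x + v x) + (a *: u y + v y)).
  by rewrite ul vl !scalerDr addrACA !scalerA mulrC.
move=> x.
have aux : (fun z => a *: u z : R^o) @ x --> (a *: u x : R^o).
  by apply: (@cvgZ R R^o); [exact: cvg_cst|exact: uc].
exact: (cvgD aux (vc x)).
Qed.

HB.instance Definition _ :=
  GRing.isSubmodClosed.Build R (X -> R^o) dual_pred dual_submod_closed.
HB.instance Definition _ := [isSub for dual_val].
HB.instance Definition _ := [Choice of dual by <:].
HB.instance Definition _ := [SubChoice_isSubLmodule of dual by <:].

Lemma dual_linear (f : dual) : linear f.
Proof. by case: f => f /= /asboolP[]. Qed.

Lemma dual_continuous (f : dual) : continuous f.
Proof. by case: f => f /= /asboolP[]. Qed.

HB.instance Definition _ (f : dual) :=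
  GRing.isLinear.Build R X R^o *:%R f (dual_linear f).

Definition dual_norm (f : dual) : R :=
  sup [set `|f x| | x in [set x : X | `|x| <= 1]].

Lemma dual_norm_has_sup (f : dual) :
  has_sup [set `|f x| | x in [set x : X | `|x| <= 1]].
Proof.
split; first by exists `|f 0|, 0 => //=; rewrite normr0.
have := @continuous_linear_bounded R X R^o 0 f (@dual_continuous f 0).
move=> /linear_boundedP [M [_ /(_ (M + 1))]]; rewrite ltrDl => /(_ ltr01) fM.
exists `|M + 1| => _ [x /= x1 <-]; rewrite (le_trans (fM x))//.
rewrite (le_trans (ler_norm _))// normrM normr_id.
by rewrite -[leRHS]mulr1 ler_wpM2l.
Qed.

Lemma dual_norm_ub (f : dual) (x : X) : `|f x| <= dual_norm f * `|x|.
Proof.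
have [->|x0] := eqVneq x 0; first by rewrite linear0 !normr0 mulr0.
rewrite -ler_pdivrMr ?normr_gt0//.
have -> : `|f x| / `|x| = `|f (`|x|^-1 *: x)|.
  by rewrite linearZ/= normrZ mulrC ger0_norm// invr_ge0.
apply: ub_le_sup; first by have [] := dual_norm_has_sup f.
by exists (`|x|^-1 *: x) => //=; rewrite normrZ normfV normr_id mulVf// normr_eq0.
Qed.

Let nrm_le (f : dual) (M : R) :
  (forall x : X, `|x| <= 1 -> `|f x| <= M) -> dual_norm f <= M.
Proof.
move=> fM; apply: ge_sup; first by have [] := dual_norm_has_sup f.
by move=> _ [x /= x1 <-]; exact: fM.
Qed.

Let nrm_ub1 (f : dual) (x : X) : `|x| <= 1 -> `|f x| <= dual_norm f.
Proof.
move=> x1; apply: ub_le_sup; first by have [] := dual_norm_has_sup f.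
by exists x.
Qed.

Let nrm_ge0 (f : dual) : 0 <= dual_norm f.
Proof. by apply: (le_trans (normr_ge0 (f 0))); apply: nrm_ub1; rewrite normr0. Qed.

Let nrmD f g : dual_norm (f + g) <= dual_norm f + dual_norm g.
Proof.
apply: nrm_le => x x1.
by rewrite (le_trans (ler_normD _ _))// lerD ?nrm_ub1.
Qed.

Let nrm_eq0 f : dual_norm f = 0 -> f = 0.
Proof.
move=> f0; apply: val_inj; apply/funext => x.
by apply/eqP; rewrite -normr_le0 (le_trans (dual_norm_ub f x))// f0 mul0r.
Qed.

Let nrmZ_le (l : R) f : dual_norm (l *: f) <= `|l| * dual_norm f.
Proof.
apply: nrm_le => x x1.
by rewrite [X in `|X|]/(l *: (f x)) normrZ ler_wpM2l ?nrm_ub1.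
Qed.

Let nrmZ (l : R) f : dual_norm (l *: f) = `|l| * dual_norm f.
Proof.
apply/eqP; rewrite eq_le nrmZ_le/=.
have [->|l0] := eqVneq l 0; first by rewrite normr0 mul0r.
rewrite -ler_pdivlMl ?normr_gt0// -normfV.
by apply: le_trans (nrmZ_le _ _); rewrite scalerA mulVf// scale1r.
Qed.

HB.instance Definition _ :=
  Lmodule_isNormed.Build R dual nrmD nrmZ nrm_eq0.

(* [dual] itself carries the norm topology. The weak-star topology is put on
   this alias: the coarsest topology making all evaluations continuous is the
   one induced by pointwise convergence on [X]. *)
Definition weakstar := initial_topology (fun f : dual => (f : {ptws X -> R})).

HB.instance Definition _ := Topological.on weakstar.

Definition dual_ball : set weakstar := [set f : dual | `|f| <= 1].

Definition dual_unit_ball : Type := set_type dual_ball.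

HB.instance Definition _ := Topological.on dual_unit_ball.

Fact dual_ball0 : (0 : dual) \in dual_ball.
Proof. by apply/mem_set; rewrite /dual_ball/= (@normr0 _ dual). Qed.

HB.instance Definition _ := isPointed.Build dual_unit_ball (SigSub dual_ball0).

Definition dual_unit_ball_val (f : dual_unit_ball) : dual := set_val f.

End Dual.

Section InjectiveTensor.
Variables (R : realType) (X Y : normedModType R).

Local Notation BXY := (dual_unit_ball X * dual_unit_ball Y)%type.

(* X (x) Y is realized by the functions (f, g) |-> sum_i f(x_i) g(y_i) on the
   product of the dual unit balls. By Hahn-Banach this is a faithful copy of
   the algebraic tensor product, and the supremum norm of [linf] is on it the
   injective norm (see [algebraic_tensor_normE]). As [linf] is complete, the
   completion is the closure of this copy. *)
Definition tensor_fun (x : X) (y : Y) : BXY -> R^o :=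
  fun p => dual_unit_ball_val p.1 x * dual_unit_ball_val p.2 y.

Fact tensor_subproof x y : tensor_fun x y \in @linf_pred R BXY.
Proof.
have ball_ub (Z : normedModType R) (z : Z) (f : dual_unit_ball Z) :
    `|dual_unit_ball_val f z| <= `|z|.
  have f1 : `|dual_unit_ball_val f| <= 1 := set_valP f.
  rewrite (le_trans (dual_norm_ub _ _))//.
  by rewrite -[leRHS]mul1r ler_wpM2r.
apply/asboolP; exists (`|x| * `|y|) => -[f g].
by rewrite normrM ler_pM ?ball_ub.
Qed.

Definition tensor x y : linf R BXY := Linf (tensor_subproof x y).

Definition algebraic_tensor : set (linf R BXY) :=
  [set h | exists n (x : 'I_n -> X) (y : 'I_n -> Y),
     h = \sum_(i < n) tensor (x i) (y i)].

Lemma algebraic_tensor_normE n (x : 'I_n -> X) (y : 'I_n -> Y) :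
  `|\sum_(i < n) tensor (x i) (y i)| =
  sup [set `|\sum_(i < n)
      dual_unit_ball_val p.1 (x i) * dual_unit_ball_val p.2 (y i)|
    | p in [set: BXY]].
Proof.
rewrite linf_normE; congr (sup [set _ | _ in _]); apply/funext => p.
congr `|_|; exact: (big_morph (fun h : linf R BXY => h p : R)).
Qed.

Fact algebraic_tensorD a u v :
  algebraic_tensor u -> algebraic_tensor v -> algebraic_tensor (a *: u + v).
Proof.
move=> [n [x [y ->]]] [m [z [t ->]]].
exists (n + m)%N, (fun k : 'I_(n + m) => match fintype.split k with
                         | inl i => a *: x i | inr j => z j end),
  (fun k : 'I_(n + m) => match fintype.split k with inl i => y i | inr j => t j end).
rewrite big_split_ord/= scaler_sumr; congr (_ + _); apply: eq_bigr => i _.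
  case: splitP => [j /= /val_inj <-|j /= ij]; last first.
    by have := ltn_ord i; rewrite ij ltnNge leq_addr.
  apply: val_inj; apply/funext => -[f g] /=.
  rewrite -[LHS]/(a * (dual_unit_ball_val f (x i) * dual_unit_ball_val g (y i))).
  by rewrite /tensor_fun/= linearZ/= mulrA.
case: splitP => [j /= ij|j /= /addnI/val_inj <-//].
by have := ltn_ord j; rewrite -ij ltnNge leq_addr.
Qed.

Definition injective_tensor_pred : {pred linf R BXY} :=
  fun h => `[< closure algebraic_tensor h >].

Fact injective_tensor_submod_closed : submod_closed injective_tensor_pred.
Proof.
split.
  apply/asboolP/subset_closure; exists 0%N, (fun=> 0), (fun=> 0).
  by rewrite big_ord0.
move=> a u v /asboolP cu /asboolP cv; apply/asboolP.
move=> B.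
have sc : continuous (fun p : linf R BXY * linf R BXY => a *: p.1 + p.2).
  move=> p; apply: cvgD; last exact: cvg_snd.
  by apply: cvgZ; [exact: cvg_cst|exact: cvg_fst].
move=> /(sc (u, v))[[U V]] /= [/cu[u' [Tu' Uu']] /cv[v' [Tv' Vv']]] UVB.
exists (a *: u' + v'); split; first exact: algebraic_tensorD.
exact: (UVB (u', v')).
Qed.

HB.instance Definition _ := GRing.isSubmodClosed.Build R (linf R BXY)
  injective_tensor_pred injective_tensor_submod_closed.

Definition injective_tensor := subnormed injective_tensor_pred.

HB.instance Definition _ := NormedModule.on injective_tensor.

Fact injective_tensor_closed : closed [set h | h \in injective_tensor_pred].
Proof.
rewrite (_ : [set _ | _] = closure algebraic_tensor); first exact: closed_closure.
by apply/seteqP; split => h /asboolP.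
Qed.

HB.instance Definition _ := Uniform_isComplete.Build injective_tensor
  (subnormed_complete injective_tensor_closed).

End InjectiveTensor.

Definition frechet_urysohn (T : topologicalType) : Prop :=
  forall (A : set T) (x : T), closure A x ->
    exists2 u : nat -> T, (forall n, A (u n)) & u @ \oo --> x.

Definition corson_property_C (R : realType) (Z : normedModType R) : Prop :=
  forall F : set (set Z),
    (forall C, F C -> convex_set C /\ closed C) ->
    \bigcap_(C in F) C = set0 ->
    exists G : set (set Z),
      [/\ G `<=` F, countable G & \bigcap_(C in G) C = set0].

Definition separable_set (T : topologicalType) (S : set T) : Prop :=
  exists D : set T, [/\ D `<=` S, countable D & S `<=` closure D].

Section Borel.
Variables (R : realType) (K : ptopologicalType).

Definition borelType : measurableType _ := g_sigma_algebraType (@open K).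

(* The complement of the largest open null set, for regular measures. *)
Definition measure_support (mu : set borelType -> \bar R) : set K :=
  [set x | forall U : set K, open U -> U x -> (0 < mu U)%E].

Definition regular_measure (mu : set borelType -> \bar R) : Prop :=
  forall A : set borelType, measurable A ->
    mu A = ereal_inf [set mu U | U in [set U : set K | open U /\ A `<=` U]] /\
    mu A = ereal_sup [set mu C | C in [set C : set K | compact C /\ C `<=` A]].

Definition property_M : Prop :=
  forall mu : probability borelType R,
    regular_measure mu -> separable_set (measure_support mu).

End Borel.

Definition weakly_lindelof_determined (R : realType) (X : normedModType R)
    : Prop :=
  exists (G : Type) (Phi : {linear dual X -> linf_c R G}),
    [/\ inhabited G, continuous Phi, injective Phi &
        continuous (fun f : weakstar X => (subnormed_val (Phi f) : {ptws G -> R}))].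

(* Main.v *)
From HB Require Import structures.
Require Import Defs.
From mathcomp Require Import all_boot all_order all_algebra.
From mathcomp Require Import all_classical all_reals all_analysis.
From mathcomp Require Import wochoice ring lra.

Set Implicit Arguments.
Unset Strict Implicit.
Unset Printing Implicit Defensive.

Import Order.TTheory GRing.Theory Num.Theory.
Import numFieldNormedType.Exports.

Local Open Scope classical_set_scope.
Local Open Scope card_scope.
Local Open Scope ring_scope.

(** The space is the closed linear span [X] of the coordinate functions [e_g],
    [g] in an [omega_1]-ordered index set, on a set of points
    [s : G -> {-1, 0, 1}]. With CH one lists all sequences of indices, and [s]
    is admissible when [s g <> 0] forces the averages of [s] along suitably long
    initial blocks of each sequence listed before [g] to be small.
    - A functional on [X] that is [>= c > 0] on uncountably many [e_g] would be
      [>= c] on a sum of [n] successive block averages divided by [n], whose norm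
      is about [1 / n]: at an admissible point all averages before the last
      non-zero one are small. So functionals have countable support, and [X] is
      WLD.
    - For finitely many indices, random signs switched off when a constraint fails
      give orthogonal coordinates, and by Chebyshev each coordinate is switched off
      with probability at most 1/2. Hahn-Banach glues these finite samples into
      a mean [M] on bounded functions of admissible points with [M |e_g| >= 1/2]
      for all [g].
    - [M] extends to a regular Borel probability on the dual ball; no separable
      set supports it, since points of the ball have countable support while
      each [{f | f e_g <> 0}] has positive measure.
    - [u |-> M (u (delta_s, delta_s))] is a functional of norm at most 1 on the
      injective tensor product that is [>= 1/2] on all [e_g (x) e_g], whereas any
      countable set of elementary functionals [f (x) h] vanishes on some
      [e_g (x) e_g]. This contradicts property (C).
    The last claim follows because a Banach space with a Frechet-Urysohn dual ball
    has property (C): if closed convex sets have the countable intersection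
    property, a common point is the limit of a Cauchy sequence whose distances to
    all countable intersections decrease geometrically. *)

(** * The Hahn-Banach theorem *)

Section HahnBanach.
Context {R : realType} {E : lmodType R}.
Implicit Types (p q : E -> R) (K : set (E * R)).

(** Homogeneity is demanded as an inequality for [t > 0], the form easiest to check for infima;
    equality for [t >= 0] follows in [sublinearZ]. *)
Definition sublinear q :=
  (forall x y, q (x + y) <= q x + q y) /\
  (forall t x, 0 < t -> q (t *: x) <= t * q x).

Lemma sublinear0 q : sublinear q -> q 0 = 0.
Proof.
move=> [qD qZ]; have := qD 0 0; rewrite addr0 => q1.
have h : (0 : R) < 1 / 2 by lra.
by have := qZ (1 / 2) 0 h; rewrite scaler0 => q2; lra.
Qed.

Lemma sublinearZ q t x : sublinear q -> 0 <= t -> q (t *: x) = t * q x.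
Proof.
move=> sq; rewrite le_eqVlt => /orP[/eqP<-|t0].
  by rewrite scale0r sublinear0// mul0r.
apply/eqP; rewrite eq_le sq.2//= mulrC -ler_pdivlMr//.
have ti : 0 < t^-1 by rewrite invr_gt0.
have := sq.2 t^-1 (t *: x) ti.
by rewrite scalerA mulVf ?gt_eqF// scale1r mulrC.
Qed.

(** A pair [(w, r)] in [K] encodes the demand [r <= L w] on the functional [L] sought. *)
Definition cone K :=
  [/\ K (0, 0), (forall u v, K u -> K v -> K (u.1 + v.1, u.2 + v.2))
    & (forall t u, 0 < t -> K u -> K (t *: u.1, t * u.2))].

(** A linear [L <= p] meeting the demands satisfies [L v = L (v + w) - L w <= p (v + w) - r]; this
    is the infimum of these bounds. *)
Definition cone_inf p K (v : E) : R := inf [set p (v + u.1) - u.2 | u in K].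

Section ConeInf.
Variables (p : E -> R) (K : set (E * R)).
Hypotheses (sp : sublinear p) (cK : cone K).
Hypothesis pK : forall w r, K (w, r) -> r <= p w.

Lemma cone_inf_lbound v : lbound [set p (v + u.1) - u.2 | u in K] (- p (- v)).
Proof.
move=> _ [[w r] Kwr <-] /=; have := pK Kwr.
have := sp.1 (v + w) (- v); rewrite addrAC subrr add0r; lra.
Qed.

Lemma cone_inf_le v w r : K (w, r) -> cone_inf p K v <= p (v + w) - r.
Proof.
move=> Kwr; apply: ge_inf; first by exists (- p (- v)); exact: cone_inf_lbound.
by exists (w, r).
Qed.

Lemma le_cone_inf v c :
  (forall w r, K (w, r) -> c <= p (v + w) - r) -> c <= cone_inf p K v.
Proof.
move=> h; apply: lb_le_inf; last by move=> _ [[w r] Kwr <-]; exact: h.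
by case: cK => K0 _ _; exists (p (v + 0) - 0), (0, 0).
Qed.

Lemma cone_inf_sublinear : sublinear (cone_inf p K).
Proof.
case: (cK) => K0 KD KZ; split=> [x y|t x t0].
  rewrite -lerBlDr; apply: le_cone_inf => w r Kwr.
  rewrite lerBlDr -lerBlDl; apply: le_cone_inf => w' r' Kwr'.
  have := cone_inf_le (x + y) (KD _ _ Kwr Kwr') => /=.
  have := sp.1 (x + w) (y + w'); rewrite addrACA; lra.
rewrite -ler_pdivrMl//; apply: le_cone_inf => w r Kwr.
rewrite ler_pdivrMl//; apply: le_trans (cone_inf_le _ (KZ _ _ t0 Kwr)) _ => /=.
by rewrite -scalerDr (sublinearZ _ sp (ltW t0)) mulrBr.
Qed.

End ConeInf.

(* Zorn's lemma yields a minimal sublinear functional below [q]; it is linear,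
   since [p x <= p (x + y) - p y] for all [x], [y] by minimality. *)
Lemma hahn_banach q :
  sublinear q -> exists L : E -> R^o, linear L /\ forall x, L x <= q x.
Proof.
move=> sq.
pose T := {p : E -> R | sublinear p /\ forall x, p x <= q x}.
pose le (p p' : T) := `[< forall x, sval p' x <= sval p x >].
have [||||p pmin] := @Zorn T le.
- by move=> p; apply/asboolP.
- move=> a b c /asboolP ab /asboolP bc; apply/asboolP => x.
  exact: le_trans (bc x) (ab x).
- move=> [a a1] [b b1] /asboolP /= ab /asboolP /= ba; apply: eq_exist.
  by apply/funext => x; apply/eqP; rewrite eq_le ab ba.
- move=> A Atot.
  have [->|/set0P[a0 Aa0]] := eqVneq A set0; first by exists (exist _ q (conj sq (fun=> lexx _))).
  pose m x := inf [set sval a x | a in A].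
  have lbA x : lbound [set sval a x | a in A] (- q (- x)).
    move=> _ [[a [sa aq]] Aa <-] /=; have := aq (- x).
    by have := sa.1 x (- x); rewrite subrr (sublinear0 sa); lra.
  have mle x a : A a -> m x <= sval a x.
    by move=> Aa; apply: ge_inf; [exists (- q (- x))|exists a].
  have lemm x c : (forall a, A a -> c <= sval a x) -> c <= m x.
    move=> h; apply: lb_le_inf => [|_ [a Aa <-]]; last exact: h.
    by exists (sval a0 x), a0.
  have sm : sublinear m.
    split=> [x y|t x t0].
      rewrite -lerBlDr; apply: (lemm _ _) => a Aa; rewrite lerBlDr -lerBlDl.
      apply: (lemm y) => b Ab; rewrite lerBlDl.
      have [/asboolP ab|/asboolP ba] := Atot _ _ Aa Ab.
        apply: le_trans (mle _ _ Ab) _; apply: le_trans ((svalP b).1.1 _ _) _.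
        by rewrite lerD2r; exact: ab.
      apply: le_trans (mle _ _ Aa) _; apply: le_trans ((svalP a).1.1 _ _) _.
      by rewrite lerD2l; exact: ba.
    rewrite -ler_pdivrMl//; apply: (lemm _ _) => a Aa; rewrite ler_pdivrMl//.
    by apply: le_trans (mle _ _ Aa) _; exact: (svalP a).1.2.
  have mq x : m x <= q x by apply: le_trans (mle _ _ Aa0) _; exact: (svalP a0).2.
  by exists (exist _ m (conj sm mq)) => s As; apply/asboolP => x; exact: mle.
case: p pmin => p [sp pq] pmin.
have pD x y : p (x + y) = p x + p y.
  apply/eqP; rewrite eq_le sp.1/=.
  (* [K] is the ray through [(y, p y)]. Minimality gives [cone_inf p K = p], and the bound at
     [(y, p y)] itself is the wanted inequality. *)
  pose K := [set u : E * R | exists2 t, 0 <= t & u = (t *: y, t * p y)].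
  have cK : cone K.
    split=> [|_ _ [t t0 ->] [s s0 ->]|t _ t0 [s s0 ->]] /=.
    - by exists 0 => //; rewrite scale0r mul0r.
    - by exists (t + s); rewrite ?addr_ge0// scalerDl mulrDl.
    - by exists (t * s); rewrite ?mulr_ge0 ?(ltW t0)// scalerA mulrA.
  have pK w r : K (w, r) -> r <= p w.
    by move=> [t t0 [-> ->]]; rewrite (sublinearZ _ sp t0).
  have Ky : K (y, p y) by exists 1; rewrite ?scale1r ?mul1r.
  have K0 : K (0, 0) by case: cK.
  have pKq z : cone_inf p K z <= q z.
    apply: le_trans (cone_inf_le sp pK z K0) _; rewrite addr0 subr0; exact: pq.
  have := pmin (exist _ (cone_inf p K) (conj (cone_inf_sublinear sp cK pK) pKq)).
  have -> : le (exist _ p (conj sp pq)) (exist _ (cone_inf p K) (conj (cone_inf_sublinear sp cK pK) pKq)).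
    apply/asboolP => z /=; apply: le_trans (cone_inf_le sp pK z K0) _.
    by rewrite addr0 subr0.
  move=> /(_ isT) /(congr1 sval) /= pE.
  have := cone_inf_le sp pK x Ky; rewrite pE; lra.
have pN x : p (- x) = - p x.
  by have := pD x (- x); rewrite subrr (sublinear0 sp); lra.
exists p; split=> [a x y|//]; rewrite pD; congr (_ + _).
have [a0|a0] := leP 0 a; first exact: sublinearZ.
rewrite -[a]opprK scaleNr pN (sublinearZ _ sp) ?oppr_ge0 ?(ltW a0)//.
by rewrite -mulNr.
Qed.

(** Any linear [L <= cone_inf p K] works: the element [(0, 0)] of [K] gives [L <= p], and evaluation
    at [- w] gives [- L w <= p 0 - r]. *)
Lemma hahn_banach_cone p K :
  sublinear p -> cone K -> (forall w r, K (w, r) -> r <= p w) ->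
  exists L : E -> R^o,
    [/\ linear L, (forall x, L x <= p x) & forall w r, K (w, r) -> r <= L w].
Proof.
move=> sp cK pK; have [L [Ll Lq]] := hahn_banach (cone_inf_sublinear sp cK pK).
have LN x : L (- x) = - L x.
  by rewrite -scaleN1r -[X in L X]addr0 Ll (_ : L 0 = 0) ?addr0 ?scaleN1r//;
     have := Ll (-1) 0 0; rewrite scaler0 addr0 scaleN1r addNr.
exists L; split=> // [x|w r Kwr].
  case: cK => K0 _ _; apply: le_trans (Lq x) _.
  by have := cone_inf_le sp pK x K0; rewrite addr0 subr0.
have := le_trans (Lq (- w)) (cone_inf_le sp pK (- w) Kwr).
by rewrite LN addNr (sublinear0 sp) sub0r lerN2.
Qed.

End HahnBanach.

(** * The dual unit ball *)

Lemma cvg_initial (S : choiceType) (T : topologicalType) (f : S -> T)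
    (F : set_system S) (s : S) : Filter F ->
  f @ F --> f s -> F --> (s : initial_topology f).
Proof.
by move=> FF h A [_ [[B oB <-] Bs sBA]]; apply: filterS sBA _; apply: h; exact: open_nbhs_nbhs.
Qed.

Lemma cvg_ptws (T : Type) (V : topologicalType) (F : set_system {ptws T -> V})
    (f : {ptws T -> V}) : Filter F ->
  (forall t, (fun g : {ptws T -> V} => g t) @ F --> f t) -> F --> f.
Proof. by move=> FF h; apply/cvg_sup => t; apply: cvg_initial; exact: h. Qed.

Lemma ptws_eval_continuous (T : Type) (V : topologicalType) (t : T) :
  continuous (fun g : {ptws T -> V} => g t).
Proof.
move=> f A nA.
have /cvg_sup/(_ t) h : f --> f by exact: cvg_id.
by apply: h; exact: (@initial_continuous _ V (fun g : {ptws T -> V} => g t) f A nA).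
Qed.

Lemma ultra_fmap (T U : Type) (f : T -> U) (F : set_system T) :
  UltraFilter F -> UltraFilter (f @ F).
Proof.
move=> FU; split; first exact: fmap_proper_filter.
move=> G GF FG; rewrite predeqE => A; split=> [GA|]; last exact: FG.
have [//|FnA] := in_ultra_setVsetC (f @^-1` A) FU.
have /filter_ex [? []//] : G (A `&` ~` A) by apply: filterI => //; exact: FG.
Qed.

Section Dual.
Context {R : realType} {X : normedModType R}.
Local Notation ball := (dual_unit_ball X).
Local Notation ev := (@dual_unit_ball_val R X).

Lemma dual_norm_le (f : dual X) (M : R) :
  (forall x, `|x| <= 1 -> `|f x| <= M) -> `|f| <= M.
Proof.
move=> fM; apply: ge_sup; first by have [] := dual_norm_has_sup f.
by move=> _ [x /= x1 <-]; exact: fM.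
Qed.

Lemma dual_of_bounded (L : X -> R^o) (M : R) : 0 <= M -> linear L ->
  (forall x, `|L x| <= M * `|x|) -> exists f : dual X, `|f| <= M /\ f =1 L.
Proof.
move=> M0 Ll LM.
pose Llin : {linear X -> R^o} := HB.pack L (GRing.isLinear.Build R X R^o *:%R L Ll).
have Lc : continuous L.
  apply: (@bounded_linear_continuous _ _ _ Llin).
  apply/linear_boundedP; exists M; split; first exact: ger0_real.
  move=> r Mr x; apply: le_trans (LM x) _; apply: ler_wpM2r => //; exact: ltW.
have Ld : L \in @dual_pred R X by apply/asboolP.
exists (Dual Ld); split=> //; apply: dual_norm_le => x x1.
by apply: le_trans (LM x) _; rewrite -[leRHS]mulr1 ler_wpM2l.
Qed.

Lemma dual_ball_norm (f : ball) : `|ev f| <= 1.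
Proof. exact: set_valP f. Qed.

Lemma dual_ball_of (f : dual X) : `|f| <= 1 -> exists g : ball, ev g = f.
Proof. by move=> f1; exists (SigSub (mem_set (f1 : dual_ball f))). Qed.

Lemma dual_ball_le (f : ball) x : `|ev f x| <= `|x|.
Proof.
apply: le_trans (dual_norm_ub _ _) _; rewrite -[leRHS]mul1r ler_wpM2r//.
exact: dual_ball_norm.
Qed.

Lemma dual_ball_inj (f g : ball) : ev f =1 ev g -> f = g.
Proof.
move=> fg; apply: val_inj; apply: val_inj; exact/funext.
Qed.

Lemma dual_ball_cvg (F : set_system ball) (f : ball) : Filter F ->
  (forall x, (fun g : ball => ev g x) @ F --> (ev f x : R)) -> F --> f.
Proof.
move=> FF h; apply: (@cvg_initial _ (weakstar X) set_val F f FF).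
apply: cvg_initial; apply: cvg_ptws => x; exact: h.
Qed.

Lemma dual_ball_eval_continuous x : continuous (fun g : ball => ev g x : R).
Proof.
move=> f.
have h1 : set_val @ f --> (set_val f : weakstar X).
  exact: (@initial_continuous ball (weakstar X) set_val f).
have h2 : (fun g : dual X => (g : {ptws X -> R})) @ (set_val f : weakstar X) --> (ev f : {ptws X -> R}).
  exact: (@initial_continuous (dual X) {ptws X -> R} (fun g : dual X => (g : {ptws X -> R})) (set_val f)).
have h3 := @ptws_eval_continuous X R x (ev f).
exact: (cvg_comp _ _ (cvg_comp _ _ h1 h2) h3).
Qed.

Lemma dual_ball_nbhs (f : ball) (U : set ball) : nbhs f U ->
  exists (s : seq X) (e : R), 0 < e /\
    forall g : ball, (forall x, x \in s -> `|ev g x - ev f x| < e) -> U g.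
Proof.
(* [G] is the filter generated by the basic weak-star neighbourhoods of [f]; the claim says that [G]
   converges to [f], which [dual_ball_cvg] tests pointwise. *)
pose G : set_system ball := [set V | exists (s : seq X) (e : R), 0 < e /\
    forall g : ball, (forall x, x \in s -> `|ev g x - ev f x| < e) -> V g].
have GF : Filter G.
  split; first by exists [::], 1; split.
    move=> P Q [s [e [e0 h]]] [t [d [d0 k]]].
    exists (s ++ t), (Num.min e d); split; first by rewrite lt_min e0.
    move=> g gst; split; [apply: h|apply: k] => x xs;
      by have := gst x; rewrite mem_cat xs ?orbT => /(_ isT); rewrite lt_min => /andP[].
  by move=> P Q PQ [s [e [e0 h]]]; exists s, e; split=> // g /h /PQ.
suff : G --> f by apply.
apply: dual_ball_cvg => x; apply/cvgrPdist_lt => e e0.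
suff : G [set g : ball | `|ev f x - ev g x| < e] by [].
by exists [:: x], e; split=> // g /(_ x); rewrite inE eqxx distrC; apply.
Qed.

Lemma dual_ball_hausdorff : hausdorff_space ball.
Proof.
move=> f g fg; apply: dual_ball_inj => x; apply: norm_hausdorff => A B fA gB.
have [h [hA hB]] := fg _ _ (dual_ball_eval_continuous fA) (dual_ball_eval_continuous gB).
by exists (ev h x).
Qed.

(** Banach-Alaoglu: along an ultrafilter the values at each [x] converge in a segment, and the
    pointwise limit is linear and bounded by the norm. *)
Lemma dual_ball_compact : compact [set: ball].
Proof.
rewrite compact_ultra => F FU _.
have xF x : exists l : R, (fun g : ball => ev g x) @ F --> l.
  have cK : compact [set` `[- `|x|, `|x|]] by exact: segment_compact.
  move: cK; rewrite compact_ultra => /(_ ((fun g : ball => (ev g x : R)) @ F)) [].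
    exact: ultra_fmap.
    apply: (@filterE _ F) => g /=.
    by rewrite in_itv/= -ler_norml dual_ball_le.
  by move=> l [_ ?]; exists l.
have [l lP] := choice xF.
have FP : ProperFilter F := @ultra_proper _ F FU.
have lM x : `|l x| <= 1 * `|x|.
  rewrite mul1r; have h : (fun g : ball => `|ev g x|) @ F --> `|l x| by apply: cvg_norm; exact: lP.
  apply: (cvgr_to_le h); apply: (@filterE _ F) => g; exact: dual_ball_le.
have ll : linear (l : X -> R^o).
  move=> a x y.
  have h : (fun g : ball => a * ev g x + ev g y : R) @ F --> (a * l x + l y : R).
    by apply: cvgD; [apply: cvgM; [exact: cvg_cst|exact: lP]|exact: lP].
  apply: (@cvg_unique _ (@norm_hausdorff _ R) ((fun g : ball => a * ev g x + ev g y : R) @ F)) => //.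
  have -> : (fun g : ball => a * ev g x + ev g y : R) = (fun g : ball => ev g (a *: x + y) : R).
    by apply/funext => g; rewrite linearP.
  exact: lP.
have [f [f1 fl]] := dual_of_bounded ler01 ll lM.
have [g gf] := dual_ball_of f1.
exists g; split=> //; apply: dual_ball_cvg => x; rewrite gf fl; exact: lP.
Qed.

End Dual.

(** * Weakly Lindelof determined spaces *)

Lemma countable_enum (T : Type) (A : set T) (x0 : T) :
  countable A -> exists e : nat -> T, A `<=` range e.
Proof.
move=> /countable_injP[f fI].
pose P n := [set x | A x /\ f x = n].
have h n : exists x, P n !=set0 -> P n x.
  by have [->|/set0P[x Px]] := eqVneq (P n) set0; [exists x0 => -[]|exists x].
have [e eP] := choice h; exists e => x Ax; exists (f x) => //.
have [Ae fe] : P (f x) (e (f x)) by apply: eP; exists x.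
by apply: fI => //; apply/mem_set.
Qed.

Section WLD.
Context {R : realType} {X : normedModType R}.
Local Notation ball := (dual_unit_ball X).
Local Notation ev := (@dual_unit_ball_val R X).

(* A closure point of a set in a Sigma-product is reached by controlling, at
   stage [n], the first [n] coordinates in the supports of the limit point and
   of all earlier terms: outside the union of these supports everything is 0. *)
Lemma weakly_lindelof_determined_frechet_urysohn :
  weakly_lindelof_determined X -> frechet_urysohn ball.
Proof.
move=> [G [Phi [[g0] _ Pinj Pc]]] A f clA.
pose phi (g : ball) (x : G) : R := subnormed_val (Phi (ev g)) x.
have phic x : continuous (phi^~ x).
  move=> g.
  have h1 : set_val @ g --> (set_val g : weakstar X).
    exact: (@initial_continuous ball (weakstar X) set_val g).
  have h2 := Pc (set_val g : weakstar X).
  have h3 := @ptws_eval_continuous G R x (subnormed_val (Phi (ev g))).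
  exact: (cvg_comp _ _ (cvg_comp _ _ h1 h2) h3).
have supp g : exists e : nat -> G, [set x | phi g x != 0] `<=` range e.
  apply: countable_enum => //.
  have : subnormed_val (Phi (ev g)) \in @linf_c_pred R G by case: (Phi (ev g)).
  by move/asboolP.
have [e eP] := choice supp.
have next (l : seq ball) : exists a, A a /\ forall g j, g \in f :: l ->
    (j < size l)%N -> `|phi f (e g j) - phi a (e g j)| < (size l).+1%:R^-1.
  have : nbhs f [set a | forall g j, g \in f :: l -> (j < size l)%N ->
      `|phi f (e g j) - phi a (e g j)| < (size l).+1%:R^-1].
    have near1 x : nbhs f [set a | `|phi f x - phi a x| < (size l).+1%:R^-1].
      by have /cvgrPdist_lt/(_ (size l).+1%:R^-1) := phic x f; apply; rewrite invr_gt0.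
    pose xs := [seq e g j | g <- f :: l, j <- iota 0 (size l)].
    have : nbhs f [set a | forall x, List.In x xs -> `|phi f x - phi a x| < (size l).+1%:R^-1].
      elim: xs => [|x xs IH]; first by apply: filterE => a y [].
      by apply: filterS2 (near1 x) IH => a ax axs y [<-//|]; exact: axs.
    apply: filterS => a ha g j gl jl; apply: ha.
    rewrite /xs; elim: (f :: l) gl => [//|h s IH]; rewrite inE => /orP[/eqP <-|/IH].
      apply: List.in_or_app; left.
      have : j \in iota 0 (size l) by rewrite mem_iota.
      elim: (iota _ _) => [//|i t IHt]; rewrite inE => /orP[/eqP <-|/IHt]; first by left.
      by right.
    by move=> ?; apply: List.in_or_app; right.
  by move=> /clA[a [Aa ha]]; exists a.
have [nx nxP] := choice next.
pose L := fix L n := if n is n'.+1 then nx (L n') :: L n' else [::].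
have sL n : size (L n) = n by elim: n => //= n ->.
pose u n := nx (L n).
have uL m n : (m < n)%N -> u m \in L n.
  elim: n => // n IH; rewrite ltnS leq_eqVlt => /orP[/eqP->|/IH] /=.
    by rewrite inE eqxx.
  by rewrite inE orbC => ->.
exists u => [n|]; first exact: (nxP (L n)).1.
have cu g x : (g = f \/ exists m, g = u m) -> phi g x != 0 ->
    (fun n => phi (u n) x) @ \oo --> phi f x.
  move=> gE /(eP g)[j _ jx]; apply/cvgrPdist_lt => d d0.
  have [m gm] : exists m, forall n, (m <= n)%N -> g \in f :: L n.
    case: gE => [->|[m ->]]; first by exists 0%N => n _; rewrite inE eqxx.
    by exists m.+1 => n mn; rewrite inE uL ?orbT.
  have : \forall n \near \oo, n.+1%:R^-1 < d :> R by exact: near_infty_natSinv_lt (PosNum d0).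
  apply: filterS2 (nbhs_infty_ge (maxn m j.+1)) => n.
  rewrite /= geq_max => /andP[mn jn] nd.
  apply: lt_trans nd; have := (nxP (L n)).2 g j (gm _ mn).
  by rewrite sL -jx; apply.
have cvgphi x : (fun n => phi (u n) x) @ \oo --> phi f x.
  have [fx|/(cu f x (or_introl erefl))//] := eqVneq (phi f x) 0.
  have [[m um]|h] := pselect (exists m, phi (u m) x != 0).
    by apply: (cu (u m)) => //; right; exists m.
  rewrite (_ : (fun n => _) = fun=> 0); last first.
    apply/funext => n; apply/eqP/negPn/negP => un; apply: h; by exists n.
  by rewrite fx; exact: cvg_cst.
(* By compactness it suffices that [f] is the only cluster point of [u]; the coordinates of [Phi]
   converge, and they determine a functional since [Phi] is injective. *)
apply: (@compact_cluster_set1 _ f _ setT) => //.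
- exact: dual_ball_hausdorff.
- exact: dual_ball_compact.
- exact: filterT.
- exact: filterT.
have clu g : cluster (u @ \oo) g -> g = f.
  move=> gc; apply: dual_ball_inj => y; congr (dual_val _ y).
  apply: Pinj; apply: val_inj; apply: val_inj; apply/funext => x.
  apply/esym; apply: (@norm_hausdorff _ R) => U V Uf Vg.
  have [h [hU hV]] := gc ((phi^~ x) @^-1` U) _ (cvgphi x U Uf) (phic x g V Vg).
  by exists (phi h x).
have [g [_ gc]] := @dual_ball_compact R X (u @ \oo) _ filterT.
by apply/seteqP; split => [h /clu//|h ->]; rewrite -(clu _ gc).
Qed.

End WLD.

(** * Property (C) *)

Section Separation.
Context {R : realType} {Z : normedModType R}.

Lemma convex_setZD (C : set Z) t x y : convex_set C -> 0 <= t -> t <= 1 ->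
  C x -> C y -> C (t *: x + (1 - t) *: y).
Proof.
move=> cC t0 t1 Cx Cy.
by have /set_mem := cC x y (Itv01 t0 t1) (mem_set Cx) (mem_set Cy).
Qed.

(** Hahn-Banach for the norm and the cone generated by the pairs [(x - z, d)], [x] in [C]; the
    distance hypothesis is the compatibility needed. *)
Lemma convex_separation (C : set Z) (z : Z) (d : R) :
  convex_set C -> C !=set0 -> 0 <= d -> (forall x, C x -> d <= `|x - z|) ->
  exists f : dual Z, `|f| <= 1 /\ forall x, C x -> d <= f (x - z).
Proof.
move=> cC [c Cc] d0 Cd.
pose p (v : Z) : R := `|v|.
have sp : sublinear p.
  by split=> [x y|t x t0]; rewrite /p ?ler_normD// normrZ gtr0_norm.
pose K := [set u : Z * R | exists t x, [/\ 0 <= t, C x & u = (t *: (x - z), t * d)]].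
have cK : cone K.
  split=> [|_ _ [t [x [t0 Cx ->]]] [s [y [s0 Cy ->]]]|s _ s0 [t [x [t0 Cx ->]]]] /=.
  - by exists 0, c; rewrite scale0r mul0r.
  - have [ts|ts] := eqVneq (t + s) 0.
      have -> : t = 0 by lra.
      have -> : s = 0 by lra.
      by exists 0, c; rewrite !scale0r !mul0r !addr0.
    have ts0 : 0 < t + s by rewrite lt_neqAle eq_sym ts addr_ge0.
    exists (t + s), (t / (t + s) *: x + (1 - t / (t + s)) *: y); split.
    + exact: ltW.
    + apply: convex_setZD => //; first by rewrite divr_ge0// ltW.
      by rewrite ler_pdivrMr// mul1r lerDl.
    + rewrite -mulrDl; congr (_, _).
      rewrite [in RHS]scalerBr [in RHS]scalerDr !scalerA.
      have -> : (t + s) * (t / (t + s)) = t by field.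
      have -> : (t + s) * (1 - t / (t + s)) = s by field.
      by rewrite !scalerBr scalerDl opprD addrACA.
  - by exists (s * t), x; split; rewrite ?mulr_ge0 ?(ltW s0)// scalerA mulrA.
have pK w r : K (w, r) -> r <= p w.
  move=> [t [x [t0 Cx [-> ->]]]]; rewrite /p normrZ ger0_norm//.
  by rewrite ler_wpM2l// Cd.
have [L [Ll Lp LK]] := hahn_banach_cone sp cK pK.
have Lb x : `|L x| <= 1 * `|x|.
  rewrite mul1r ler_norml Lp andbT lerNl.
  have : L (- x) <= `|x| by rewrite -(normrN x); exact: Lp.
  rewrite -scaleN1r -[X in L X]addr0 Ll (_ : L 0 = 0) ?addr0 ?scaleN1r//.
  by have := Ll (-1) 0 0; rewrite scaler0 addr0 scaleN1r addNr.
have [f [f1 fL]] := dual_of_bounded ler01 Ll Lb.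
exists f; split=> // x Cx; rewrite fL; apply: LK.
by exists 1, x; rewrite scale1r mul1r.
Qed.

End Separation.

Section PropertyC.
Context {R : realType} {Z : completeNormedModType R}.
Local Notation ball := (dual_unit_ball Z).
Local Notation ev := (@dual_unit_ball_val R Z).
Hypothesis FU : frechet_urysohn ball.
Variable F : set (set Z).
Hypothesis Fcc : forall C, F C -> convex_set C /\ closed C.

Let cap (G : set (set Z)) : set Z := [set x | forall C, G C -> C x].
Let sub G := G `<=` F /\ countable G.

(** The invariant of the successive approximation: [rho] shrinks geometrically while [z] moves. *)
Let meets z (rho : R) := forall G, sub G -> exists2 x, cap G x & `|x - z| <= rho.

Let sub_bigcup (G : nat -> set (set Z)) :
  (forall n, sub (G n)) -> sub (\bigcup_n G n).
Proof.
move=> h; split; first by move=> C [n _ GC]; exact: (h n).1.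
by apply: bigcup_countable => // n _; exact: (h n).2.
Qed.

Let subU G H : sub G -> sub H -> sub (G `|` H).
Proof.
move=> sG sH; rewrite -bigcup2E; apply: sub_bigcup => -[|[|n]] //=.
by split.
Qed.

(** Otherwise 0 lies in the closure of the functionals that are [>= rho / 2] on some [cap G] near
    [z], so a sequence of these tends to 0. The union of their families [G] is still countable, and
    a point of its intersection near [z] gives a contradiction. *)
Let meets_nbhs0 z rho : 0 < rho -> meets z rho ->
  exists (s : seq Z) (e : R), 0 < e /\ forall (g : ball) G,
    (forall x, x \in s -> `|ev g x| < e) -> sub G ->
    exists x, [/\ cap G x, `|x - z| <= rho & ev g (x - z) < rho / 2].
Proof.
move=> rho0 zrho.
pose A := [set g : ball | exists2 G, sub G & forall x, cap G x ->
   `|x - z| <= rho -> rho / 2 <= ev g (x - z)].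
have [g0 g0E] : exists g0 : ball, ev g0 = 0 by apply: dual_ball_of; rewrite normr0.
have : ~ closure A g0.
  move=> /FU[u uA ug0].
  have [G GP] := choice (fun n => (let: ex_intro2 G a b := uA n in ex_intro _ G (conj a b)) :
    exists G, sub G /\ forall x, cap G x -> `|x - z| <= rho -> rho / 2 <= ev (u n) (x - z)).
  have [x Gx xz] := zrho _ (sub_bigcup (fun n => (GP n).1)).
  have ux n : rho / 2 <= ev (u n) (x - z).
    by apply: (GP n).2 => // C GC; apply: Gx; exists n.
  have h : (fun n => ev (u n) (x - z) : R) @ \oo --> (ev g0 (x - z) : R).
    exact: (cvg_comp _ _ ug0 (@dual_ball_eval_continuous R Z (x - z) g0)).
  have : rho / 2 <= ev g0 (x - z) by apply: (cvgr_to_ge h); exact: nearW.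
  rewrite g0E => k.
  have : rho / 2 <= 0 by [].
  by apply/negP; rewrite -ltNge divr_gt0.
move=> /existsNP[U /not_implyP[/dual_ball_nbhs[s [e [e0 sU]]] AU]].
exists s, e; split=> // g G gs sG; apply: contrapT => h; apply: AU; exists g.
split; last by apply: sU => x xs; rewrite g0E [X in `|_ - X|](_ : _ = 0)// subr0; exact: gs.
by exists G => // x Gx xz; rewrite leNgt; apply/negP => gx; apply: h; exists x.
Qed.

(* [meets_nbhs0] tests functionals at finitely many points only, so Hahn-Banach
   is applied in the finite-dimensional space of values at these points; a linear
   form there is evaluation at a linear combination [z' - z] of the points. *)
Let meets_step z rho : 0 < rho -> meets z rho ->
  exists z', meets z' (3 / 4 * rho) /\ `|z' - z| <= 2 * rho.
Proof.
move=> rho0 zrho; have [s [e [e0 sP]]] := meets_nbhs0 rho0 zrho.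
pose n := size s.
pose evs (g : dual Z) : 'rV[R]_n := \row_i g s`_i.
(* The factor [rho / e] makes [p (evs g) >= rho * sg] as soon as [g] reaches [e * sg] at one point
   of [s]. *)
pose p (v : 'rV[R]_n) : R := rho / e * \sum_i `|v ord0 i|.
have re0 : 0 < rho / e by rewrite divr_gt0.
have sp : sublinear p.
  split=> [x y|t x t0]; rewrite /p.
    rewrite -mulrDr ler_wpM2l ?(ltW re0)// -big_split/=; apply: ler_sum => i _.
    by rewrite mxE ler_normD.
  rewrite mulrCA ler_wpM2l ?(ltW re0)// mulr_sumr; apply: ler_sum => i _.
  by rewrite mxE normrM gtr0_norm.
(* The demand is [r - rho / 2 * sg <= g (z' - z)]. A bound [sg] replaces the norm of [g] because
   bounds add, which keeps [K] a cone. *)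
pose K := [set u : 'rV[R]_n * R | exists (g : dual Z) (r sg : R) G,
  [/\ `|g| <= sg, sub G, (forall x, cap G x -> `|x - z| <= rho -> r <= g (x - z))
    & u = (evs g, r - rho / 2 * sg)]].
have cK : cone K.
  split=> [|_ _ [g [r [sg [G [gs sG Gr ->]]]]] [h [q [sh [H [hs sH Hq ->]]]]]
           |t _ t0 [g [r [sg [G [gs sG Gr ->]]]]]] /=.
  - exists 0, 0, 0, set0; split.
    + by rewrite normr0.
    + by split.
    + by [].
    + by congr (_, _); [apply/rowP => i; rewrite !mxE|rewrite mulr0 subr0].
  - exists (g + h), (r + q), (sg + sh), (G `|` H); split.
    + by apply: le_trans (ler_normD _ _) _; rewrite lerD.
    + exact: subU.
    + move=> x GHx xz; rewrite [leRHS](_ : _ = g (x - z) + h (x - z))//.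
      by apply: lerD; [apply: Gr|apply: Hq] => // C GC; apply: GHx; [left|right].
    + by congr (_, _); [apply/rowP => i; rewrite !mxE|ring].
  - exists (t *: g), (t * r), (t * sg), G; split=> //.
    + by rewrite normrZ gtr0_norm// ler_pM2l.
    + move=> x Gx xz; rewrite [leRHS](_ : _ = t * g (x - z))// ler_pM2l//.
      exact: Gr.
    + by congr (_, _); [apply/rowP => i; rewrite !mxE|ring].
have p_ge0 v : 0 <= p v by rewrite mulr_ge0 ?(ltW re0)// sumr_ge0.
have pK w r : K (w, r) -> r <= p w.
  move=> [g [r' [sg [G [gs sG Gr [-> ->]]]]]].
  have [x0 Gx0 x0z] := zrho _ sG.
  have sg0 : 0 <= sg by apply: le_trans gs.
  have rsg : r' <= sg * rho.
    apply: le_trans (Gr _ Gx0 x0z) _; apply: le_trans (ler_norm _) _.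
    apply: le_trans (dual_norm_ub _ _) _; apply: ler_pM => //; exact: (normr_ge0 g).
  have [sgz|sgz] := eqVneq sg 0.
    by apply: le_trans (p_ge0 _); move: rsg; rewrite sgz mul0r mulr0 subr0.
  have {sgz}sg0' : 0 < sg by rewrite lt_neqAle eq_sym sgz.
  (* Either [g] is large at a point of [s] and [p] dominates, or [g / sg] lies in the neighbourhood
     of 0 given by [meets_nbhs0], so that [r' < rho / 2 * sg]. *)
  have [[x xs gx]|h] := pselect (exists2 x, x \in s & e * sg <= `|g x|).
    have ix : (index x s < n)%N by rewrite index_mem.
    have : rho * sg <= p (evs g).
      rewrite /p (bigD1 (Ordinal ix))//= mxE/= nth_index//.
      apply: (@le_trans _ _ (rho / e * (e * sg))).
        by rewrite mulrA divfK ?gt_eqF.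
      rewrite ler_pM2l//; apply: le_trans gx _.
      by rewrite lerDl sumr_ge0.
    have : 0 <= rho / 2 * sg by rewrite mulr_ge0// divr_ge0// ltW.
    lra.
  apply: le_trans (p_ge0 _).
  have [g' g'E] : exists g' : ball, ev g' = sg^-1 *: g.
    apply: dual_ball_of; rewrite normrZ normfV gtr0_norm// ler_pdivrMl//.
    by rewrite mulr1.
  have [|x [Gx xz]] := sP g' G _ sG.
    move=> x xs; rewrite g'E [X in `|X|](_ : _ = sg^-1 * g x)//.
    rewrite normrM normfV (gtr0_norm sg0') ltr_pdivrMl// mulrC ltNge.
    by apply/negP => gx; apply: h; exists x.
  rewrite g'E [ltLHS](_ : _ = sg^-1 * g (x - z))// ltr_pdivrMl// => gx.
  by have := Gr _ Gx xz; lra.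
have [L [Ll Lp LK]] := hahn_banach_cone sp cK pK.
pose Llin : {linear 'rV[R]_n -> R^o} := HB.pack L (GRing.isLinear.Build R _ R^o *:%R L Ll).
pose z' := z + \sum_(i < n) L (delta_mx ord0 i) *: s`_i.
have Lev (g : dual Z) : L (evs g) = g (z' - z).
  rewrite /z' addrAC subrr add0r linear_sum/= [evs g]row_sum_delta.
  rewrite -[L]/(Llin : _ -> _) linear_sum; apply: eq_bigr => i _.
  by rewrite !linearZ/= mxE; exact: mulrC.
(* If this failed, a separating [f] of norm at most 1 would have lower bound
   [3 / 4 * rho + f (z' - z)]. Its demand, at cost [rho / 2], reads [rho / 4 <= 0]. *)
have z'P G : sub G -> exists x, [/\ cap G x, `|x - z| <= rho & `|x - z'| <= 3 / 4 * rho].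
  move=> sG; apply: contrapT => h.
  pose C := [set x | cap G x /\ `|x - z| <= rho].
  have cC : convex_set C.
    move=> x y t /set_mem[Gx xz] /set_mem[Gy yz]; apply/mem_set; split.
      move=> B GB; have [cB _] := Fcc (sG.1 _ GB).
      by apply/set_mem/cB; apply/mem_set; [exact: Gx|exact: Gy].
    rewrite [X in X - z](_ : _ = t%:num *: x + (1 - t%:num) *: y)//.
    have -> : t%:num *: x + (1 - t%:num) *: y - z =
        t%:num *: (x - z) + (1 - t%:num) *: (y - z).
      rewrite !scalerBr addrACA -opprD -scalerDl.
      by rewrite [t%:num + _]addrC subrK scale1r.
    have t0 : 0 <= t%:num by [].
    have t1 : 0 <= 1 - t%:num by rewrite subr_ge0.
    apply: le_trans (ler_normD _ _) _; rewrite !normrZ !ger0_norm//.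
    have a := ler_wpM2l t0 xz; have b := ler_wpM2l t1 yz.
    by apply: le_trans (lerD a b) _; rewrite -mulrDl addrC subrK mul1r.
  have C0 : C !=set0 by have [x] := zrho _ sG; exists x.
  have r0 : 0 <= 3 / 4 * rho by rewrite mulr_ge0// ltW.
  have Cd x : C x -> 3 / 4 * rho <= `|x - z'|.
    by move=> [Gx xz]; rewrite leNgt; apply/negP => /ltW k; apply: h; exists x.
  have [f [f1 fC]] := convex_separation cC C0 r0 Cd.
  have : K (evs f, (3 / 4 * rho + f (z' - z)) - rho / 2 * 1).
    exists f, (3 / 4 * rho + f (z' - z)), 1, G; split=> // x Gx xz.
    rewrite -lerBrDr -linearB/= opprB addrA subrK; exact: fC.
  move=> /LK; rewrite Lev; lra.
exists z'; split; first by move=> G /z'P[x [? ? ?]]; exists x.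
have [|x [_ xz xz']] := z'P set0; first by split.
rewrite -(subrKA x); apply: le_trans (ler_normD _ _) _.
rewrite (distrC z'); lra.
Qed.

(** The centres from [meets_step] form a Cauchy sequence. Each [C] in [F] is a countable subfamily
    by itself, so the centres approach [C] and their limit lies in it. *)
Let meets_cap z rho : 0 < rho -> meets z rho -> cap F !=set0.
Proof.
move=> rho0 zrho.
pose P (n : nat) (z : Z) := meets z ((3 / 4) ^+ n * rho).
have st (n : nat) (y : Z) : exists y', P n y -> P n.+1 y' /\ `|y' - y| <= (3 / 4) ^+ n * (2 * rho).
  have [Py|] := pselect (P n y); last by exists 0.
  have [|y' [My' y'y]] := meets_step _ Py.
    by rewrite mulr_gt0// exprn_gt0.
  by exists y' => _; split; [rewrite /P exprS -mulrA|rewrite mulrCA].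
have [nx nxP] := choice (fun u : nat * Z => st u.1 u.2).
pose y := fix y n := if n is m.+1 then nx (m, y m) else z.
have yP n : P n (y n).
  elim: n => [|n IH]; first by rewrite /P expr0 mul1r.
  exact: (nxP (n, y n) IH).1.
have yd n : `|y n.+1 - y n| <= (3 / 4) ^+ n * (2 * rho) := (nxP (n, y n) (yP n)).2.
have yc : cvgn (series (fun n => y n.+1 - y n)).
  apply: normed_cvg; apply: (@series_le_cvg _ _ (geometric (2 * rho) (3 / 4))) => //.
  - by move=> n; exact: normr_ge0.
  - by move=> n; apply: mulr_ge0; [apply: mulr_ge0 => //; exact: ltW|exact: exprn_ge0].
  - by move=> n; rewrite /geometric/= mulrC; exact: yd.
  - by apply: is_cvg_geometric_series; rewrite ger0_norm; lra.
have {yc}/cvg_ex[l yl] : cvgn y.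
  have -> : y = (fun n => series (fun n => y n.+1 - y n) n + z).
    apply/funext => n; rewrite /series/= telescope_sumr//= subrK//.
  by apply: is_cvgD => //; exact: is_cvg_cst.
exists l => C FC; have [_ cC] := Fcc FC.
have sC : sub [set C] by split; [move=> _ ->|].
have [x xP] := choice (fun n => let: ex_intro2 x a b := yP n _ sC in
  ex_intro (fun x => cap [set C] x /\ `|x - y n| <= (3 / 4) ^+ n * rho) x (conj a b)).
apply: (@closed_cvg _ _ \oo _ x C cC); first by apply: nearW => n; exact: (xP n).1.
have d0 : (fun n => x n - y n) @ \oo --> 0.
  apply/norm_cvg0P; apply: (@squeeze_cvgr _ _ _ _ (fun=> 0) (fun n => (3 / 4) ^+ n * rho)).
  - by apply: nearW => n; rewrite normr_ge0 (xP n).2.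
  - exact: cvg_cst.
  - rewrite -[X in _ --> X](mul0r rho); apply: cvgMl.
    by apply: cvg_expr; rewrite ger0_norm; lra.
rewrite (_ : x = (fun n => (x n - y n) + y n)); last by apply/funext => n; rewrite subrK.
rewrite -[l]add0r; exact: cvgD.
Qed.

(** Some starting radius exists: otherwise every [n] has a countable [G n] whose intersection lies
    outside the ball of radius [n + 1], and the union of the [G n] has empty intersection. *)
Lemma frechet_urysohn_cap : (forall G, G `<=` F -> countable G ->
  \bigcap_(C in G) C !=set0) -> \bigcap_(C in F) C !=set0.
Proof.
move=> h.
suff [n zn] : exists n : nat, meets 0 n.+1%:R.
  by apply: meets_cap zn; rewrite ltr0n.
apply: contrapT => /forallNP nm.
have /choice[G GP] : forall n : nat, exists G, sub G /\
    forall x, cap G x -> n.+1%:R < `|x|.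
  move=> n; have /existsNP[G /not_implyP[sG Gn]] := nm n.
  exists G; split=> // x Gx; rewrite ltNge; apply/negP => xn.
  by apply: Gn; exists x => //; rewrite subr0.
have [GF Gc] := sub_bigcup (fun n => (GP n).1).
have [x Gx] := h _ GF Gc.
have := (GP (Num.truncn `|x|)).2 x.
rewrite ltNge (ltW (truncnS_gt _)) => /(_ _)/negP; apply => // C GC.
by apply: Gx; exists (Num.truncn `|x|).
Qed.

End PropertyC.

(** * An enumeration under the continuum hypothesis *)

Section Continuum.
Context {R : realType}.

(** Truncated base 3 expansion of a point of the Cantor set, with digits [2 * b i]. *)
Let ternary (b : nat -> bool) (n : nat) : R :=
  \sum_(i < n) (b i)%:R * (2 / 3) / 3 ^+ i.

Let ternaryS b n : ternary b n.+1 = ternary b n + (b n)%:R * (2 / 3) / 3 ^+ n.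
Proof. by rewrite /ternary big_ord_recr. Qed.

Let ternary_le b n m : (n <= m)%N ->
  ternary b n <= ternary b m <= ternary b n + (3 ^+ n)^-1 - (3 ^+ m)^-1.
Proof.
elim: m => [|m IH]; first by rewrite leqn0 => /eqP->; lra.
rewrite leq_eqVlt => /orP[/eqP->|]; first by apply/andP; split; lra.
rewrite ltnS => /IH /andP[h1 h2].
have e : 0 < (3 ^+ m)^-1 :> R by rewrite invr_gt0 exprn_gt0.
have -> : (3 ^+ m.+1)^-1 = (3 ^+ m)^-1 / 3 :> R by rewrite exprS invfM mulrC.
by rewrite ternaryS; case: (b m); rewrite ?mul1r ?mul0r; apply/andP; split; lra.
Qed.

Lemma bool_seq_inj : exists f : (nat -> bool) -> R, injective f.
Proof.
exists (fun b => sup (range (ternary b))) => b c bc.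
pose f b := sup (range (ternary b)).
have fub b' n : ternary b' n <= f b'.
  apply: ub_le_sup; last by exists n.
  exists 1 => _ [m _ <-]; have /andP[_] := ternary_le b' (leq0n m).
  have : 0 < (3 ^+ m)^-1 :> R by rewrite invr_gt0 exprn_gt0.
  by rewrite {2}/ternary big_ord0 expr0 invr1; lra.
have fle b' n : f b' <= ternary b' n + (3 ^+ n)^-1.
  apply: ge_sup; first by exists (ternary b' 0), 0%N.
  move=> _ [m _ <-]; have e k : 0 < (3 ^+ k)^-1 :> R by rewrite invr_gt0 exprn_gt0.
  have [nm|/ltnW mn] := leqP n m.
    by have /andP[_] := ternary_le b' nm; have := e m; lra.
  by have /andP[+ _] := ternary_le b' mn; have := e n; lra.
apply/funext; apply: contrapT => /existsNP[n0 n0P].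
have ex : exists n, b n != c n by exists n0; apply/eqP.
case: (ex_minnP ex) => n nbc nmin.
have En : ternary b n = ternary c n.
  apply: eq_bigr => i _; congr ((nat_of_bool _)%:R * _ / _); apply/eqP/negPn/negP => /nmin.
  by rewrite leqNgt ltn_ord.
(* Beyond the common truncation, [f v] gains at most [3 ^ - (n + 1)] and [f u] at least twice as
   much. *)
have main (u v : nat -> bool) : ternary u n = ternary v n -> u n -> ~~ v n -> f u = f v -> False.
  move=> uv un vn fuv; have := fub u n.+1; have := fle v n.+1.
  rewrite !ternaryS uv fuv un (negbTE vn) mul0r mul0r addr0 mul1r.
  have e : 0 < (3 ^+ n)^-1 :> R by rewrite invr_gt0 exprn_gt0.
  rewrite exprS invfM; lra.
move: nbc; case bn : (b n); case cn : (c n) => // _.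
  by apply: (main b c) => //; rewrite cn.
by apply: (main c b) => //; rewrite ?bn.
Qed.

(** A real is coded by the rationals below it, and a sequence of such codes by one boolean sequence
    through pairing. *)
Lemma real_seq_inj : exists f : (nat -> R) -> R, injective f.
Proof.
have [j jI] := bool_seq_inj.
pose cut (x : R) (k : nat) : bool :=
  if unpickle k is Some q then ratr (q : rat) < x else false.
have cutI : injective cut.
  move=> x y xy; apply: contrapT => /eqP; rewrite neq_lt => /orP[] /rat_in_itvoo[q];
    rewrite in_itv/= => /andP[q1 q2]; have := congr1 (fun f => f (pickle q)) xy;
    rewrite /cut pickleK => e.
  - by move: e; rewrite q2 ltNge (ltW q1).
  - by move: e; rewrite q2 ltNge (ltW q1).
exists (fun a => j (fun k => if unpickle k is Some (i, l) then cut (a i) l else false)).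
move=> a b /jI ab; apply/funext => i; apply: cutI; apply/funext => l.
by have := congr1 (fun f => f (pickle (i, l))) ab; rewrite pickleK.
Qed.

Lemma real_seq_enum : exists A : R -> nat -> R, forall a, exists x, A x = a.
Proof.
have [f fI] := real_seq_inj.
have h x : exists a, forall b, f b = x -> b = a.
  have [[a ax]|n] := pselect (exists a, f a = x).
    by exists a => b bx; apply: fI; rewrite ax.
  by exists (fun=> 0) => b bx; case: n; exists b.
by have [A AP] := choice h; exists A => a; exists (f a); rewrite -(AP (f a) a).
Qed.

Lemma real_uncountable : ~ countable [set: R].
Proof.
move=> /countable_lebesgue_measure0; apply/eqP.
have : ((lebesgue_measure ([set` `[0%R, 1%R]] : set R)) <= lebesgue_measure [set: R])%E.
  by apply: le_measure; rewrite ?inE//; exact: measurable_itv.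
rewrite lebesgue_measure_itv/= lte_fin ltr01 => h.
by apply/eqP => k; move: h; rewrite k sube0 lee_fin ler10.
Qed.

Definition omega1_order (lt : rel R) :=
  [/\ irreflexive lt, transitive lt, (forall x y, x != y -> lt x y || lt y x)
    & forall x, countable [set y | lt y x]].

(** Well-order [R]. If some initial segment is uncountable, the least such one is equipotent with
    [R] by CH, and its order is transported to [R]; its own initial segments are countable by
    minimality. *)
Lemma continuum_hypothesis_omega1 :
  continuum_hypothesis R -> exists lt, omega1_order lt.
Proof.
move=> CH.
have [r rwo] := @well_ordering_principle R.
have rwo' : wo_chain r predT by move=> A _ An; apply: rwo.
have rtot x y : r x y || r y x by exact: (wo_chainW rwo').
have rasym x y : r x y -> r y x -> x = y.
  by move=> xy yx; apply: (wo_chain_antisymmetric rwo') => //; rewrite xy yx.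
have min (P : set R) : P !=set0 -> exists2 z, P z & forall y, P y -> r z y.
  move=> [x Px]; have [|z [[zP zm] _]] := rwo [pred x | `[< P x >]].
    by exists x; apply/asboolP.
  exists z; first by move: zP => /asboolP.
  by move=> y Py; apply: zm; apply/asboolP.
(* Transitivity comes from comparing the three points with the least of them. *)
have rtrans : transitive r.
  move=> y x z xy yz.
  have [|w wP wm] := min [set t | t = x \/ t = y \/ t = z]; first by exists x; left.
  have wx : r w x by apply: wm; left.
  have wy : r w y by apply: wm; right; left.
  have wz : r w z by apply: wm; right; right.
  case: wP => [<-//|[wy'|wz']].
    by rewrite wy' in wx; rewrite (rasym _ _ xy wx).
  rewrite wz' in wy; have zy := rasym _ _ yz wy; by rewrite -zy.
pose lt0 x y := (x != y) && r x y.
have lt0_irr : irreflexive lt0 by move=> x; rewrite /lt0 eqxx.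
have lt0_trans : transitive lt0.
  move=> y x z /andP[nxy xy] /andP[nyz yz]; rewrite /lt0 (rtrans _ _ _ xy yz) andbT.
  by apply: contra_neq nxy => xz; apply: rasym => //; rewrite xz.
have lt0_tot x y : x != y -> lt0 x y || lt0 y x.
  by move=> xy; rewrite /lt0 [y == x]eq_sym xy/=.
have [call|/existsNP nc] := pselect (forall x, countable [set y | lt0 y x]).
  by exists lt0.
have [x0 x0u x0m] := min [set x | ~ countable [set y | lt0 y x]] nc.
have [//|/card_set_bijP [h [hD hI _]]] :
    countable [set y | lt0 y x0] \/ [set: R] #= [set y | lt0 y x0].
  by have [|] := CH [set y | lt0 y x0]; [left|right; rewrite card_eq_sym].
have {}hI : injective h by move=> x y; apply: hI; rewrite inE.
exists (fun x y => lt0 (h x) (h y)); split.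
- by move=> x; exact: lt0_irr.
- by move=> y x z; exact: lt0_trans.
- by move=> x y xy; apply: lt0_tot; rewrite (inj_eq hI).
- move=> x.
  have : countable [set y | lt0 y (h x)].
    apply: contrapT => /x0m x0h; have /= := hD x I => /andP[+ hx].
    by rewrite (rasym _ _ hx x0h) eqxx.
  move=> /countable_injP[f fI]; apply/countable_injP; exists (f \o h) => a b.
  move=> /set_mem/= ax /set_mem/= bx /fI ab; apply: hI; apply: ab; exact/mem_set.
Qed.

End Continuum.

(** * Admissible points *)

(* [block_bound k / block_size k = 1 / (k + 1)] makes block averages small;
   [block_size k / block_bound k ^ 2 = 2 ^ - (k + 2)] bounds, by Chebyshev, the
   probability that the [k]-th constraint fails; and since [block_bound k] tends
   to infinity, only finitely many constraints can fail on finite supports. *)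
Definition block_size (k : nat) : nat := (k.+1 ^ 2 * 2 ^ k.+2)%N.
Definition block_bound (k : nat) : nat := (k.+1 * 2 ^ k.+2)%N.

Definition block_family (G : eqType) (lt : rel G) (B : G -> nat -> seq G) :=
  forall g k, [/\ uniq (B g k), (size (B g k) <= block_size k)%N
                & forall x, x \in B g k -> lt x g].

Definition captures_sequences (G : eqType) (B : G -> nat -> seq G) :=
  forall a : nat -> G, injective a -> exists2 D, countable D &
    forall g, ~ D g -> forall K, exists2 k, (K <= k)%N &
      B g k = [seq a i | i <- iota 0 (block_size k)].

(** Each real [x] codes a sequence [A x], and [g] handles the countably many codes below it.
    Filtering and [undup] enforce [block_family]; they change nothing once [g] lies above the code
    and all terms of an injective sequence, that is, for all but countably many [g]. *)
Lemma continuum_hypothesis_blocks (R : realType) : continuum_hypothesis R ->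
  exists (lt : rel R) (B : R -> nat -> seq R),
    [/\ omega1_order lt, block_family lt B & captures_sequences B].
Proof.
move=> /continuum_hypothesis_omega1[lt olt]; case: (olt) => lti ltt ltot ltc.
have [A AP] := @real_seq_enum R.
have /choice[e eP] : forall g, exists e : nat -> R, [set y | lt y g] `<=` range e.
  by move=> g; apply: countable_enum.
(* every index [i] of [e g] occurs as [logn 2 k] for infinitely many [k] *)
pose B g k := [seq x <- undup [seq A (e g (logn 2 k)) i | i <- iota 0 (block_size k)] | lt x g].
exists lt, B; split=> // [g k|a aI].
  split; first by rewrite filter_uniq ?undup_uniq.
    rewrite size_filter (leq_trans (count_size _ _))//.
    by rewrite (leq_trans (size_undup _))// size_map size_iota.
  by move=> x; rewrite mem_filter => /andP[].
have [x xa] := AP a.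
have gec y : countable [set g | ~~ lt y g].
  have : [set g | ~~ lt y g] `<=` \bigcup_(b in [set: bool]) (if b then [set y] else [set g | lt g y]).
    move=> g /= yg; have [->|gy] := eqVneq g y; first by exists true.
    by exists false => //=; have := ltot _ _ gy; rewrite (negbTE yg) orbF.
  move=> /subset_card_le /sub_countable; apply.
  by apply: bigcup_countable => // -[].
exists ([set g | ~~ lt x g] `|` \bigcup_i [set g | ~~ lt (a i) g]).
  rewrite -bigcup2E; apply: bigcup_countable => // -[|[|n]] _ //=.
  by apply: bigcup_countable.
move=> g gD K.
have xg : lt x g by apply: contrapT => /negP xg; apply: gD; left.
have ag i : lt (a i) g by apply: contrapT => /negP ag; apply: gD; right; exists i.
have [j _ jx] := eP g x xg.
(* This index is at least [K] and has 2-adic valuation exactly [j]. *)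
exists (2 ^ j * K.*2.+1)%N.
  apply: leq_trans (leq_pmull _ _); last by rewrite expn_gt0.
  by rewrite -addnn leqW// leq_addr.
rewrite /B lognM ?expn_gt0// pfactorK// lognE/= dvdn2/= odd_double/= addn0 jx xa.
rewrite undup_id; first by apply/all_filterP/allP => _ /mapP[i _ ->].
by rewrite map_inj_uniq ?iota_uniq.
Qed.

(** * Finite random samples of admissible points *)

Section FiniteSamples.
Context {R : realType} {G : eqType} {lt : rel G} {B : G -> nat -> seq G}.
Hypotheses (lti : irreflexive lt) (ltt : transitive lt).
Hypothesis ltot : forall x y, x != y -> lt x y || lt y x.
Hypothesis BP : block_family lt B.
Implicit Types (s : G -> R) (L : seq (G -> R)) (F : seq G).

Definition bounded_block s g k := `|\sum_(x <- B g k) s x| <= (block_bound k)%:R.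

Definition admissible s :=
  (forall x, s x = 0 \/ `|s x| = 1) /\
  forall g, s g != 0 -> forall k, bounded_block s g k.

(** [L] is read as the uniform probability on its entries. The fourth clause is the second-moment
    bound that orthogonal coordinates would give; the last says that a coordinate of [F] is non-zero
    with probability at least 1/2. *)
Let sample F L :=
  [/\ (0 < size L)%N, (forall s, s \in L -> admissible s),
      (forall s, s \in L -> forall x, x \notin F -> s x = 0),
      (forall C, uniq C -> \sum_(s <- L) (\sum_(x <- C) s x) ^+ 2 <= (size C)%:R * (size L)%:R)
    & forall g, g \in F -> (size L)%:R <= 2 * \sum_(s <- L) `|s g|].

Let good g s := `[< forall k, bounded_block s g k >].

(* Chebyshev's inequality for each of the finitely many [k] that matter. *)
Let half_good F L g : sample F L -> (size L)%:R <= 2 * \sum_(s <- L) (good g s)%:R :> R.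
Proof.
move=> [_ Ladm Lsupp Lsq _].
have bad s : s \in L -> 1 - (good g s)%:R <= \sum_(k < size F)
    (\sum_(x <- B g k) s x) ^+ 2 / (block_bound k)%:R ^+ 2.
  move=> sL; rewrite /good; case: asboolP => [_|/existsNP[k /negP]] /=.
    by rewrite subrr sumr_ge0// => k _; rewrite divr_ge0 ?sqr_ge0.
  rewrite -ltNge => kP; rewrite subr0.
  (* Block entries are distinct and [s] vanishes off [F], so a block sum is at most [size F]; a
     failing [k] has block sum above [block_bound k > k]. *)
  have kF : (k < size F)%N.
    rewrite ltnNge; apply/negP => Fk; move: kP; apply/negP; rewrite -leNgt.
    have [Bu _ _] := BP g k.
    apply: le_trans (ler_norm_sum _ _ _) _.
    rewrite (bigID (mem F))/= [X in _ + X]big1 ?addr0; last first.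
      by move=> x xF; rewrite (Lsupp s)// normr0.
    apply: (@le_trans _ _ (\sum_(x <- B g k | x \in F) 1)).
      by apply: ler_sum => x _; have [->|->] := (Ladm s sL).1 x; rewrite ?normr0.
    rewrite -big_filter big_const_seq count_predT iter_addr_0 ler_nat.
    apply: (@leq_trans (size F)).
      apply: uniq_leq_size; first exact: filter_uniq.
      by move=> x; rewrite mem_filter => /andP[].
    apply: leq_trans Fk _; apply: leq_trans (leqnSn k) _.
    by rewrite /block_bound leq_pmulr// expn_gt0.
  rewrite (bigD1 (Ordinal kF))//= -[leLHS]addr0 lerD//; last first.
    by rewrite sumr_ge0// => i _; rewrite divr_ge0 ?sqr_ge0.
  have b0 : 0 < (block_bound k)%:R ^+ 2 :> R.
    by rewrite exprn_gt0// ltr0n muln_gt0 expn_gt0.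
  rewrite ler_pdivlMr//= mul1r.
  by rewrite -[leRHS]real_normK ?num_real// lerXn2r ?nnegrE// ltW.
have : \sum_(s <- L) (1 - (good g s)%:R) <= (size L)%:R / 2 :> R.
  apply: (@le_trans _ _ (\sum_(s <- L) \sum_(k < size F)
      (\sum_(x <- B g k) s x) ^+ 2 / (block_bound k)%:R ^+ 2)).
    by rewrite big_seq [leRHS]big_seq; apply: ler_sum => s; exact: bad.
  rewrite exchange_big/=.
  apply: (@le_trans _ _ (\sum_(k < size F) (size L)%:R * (2 ^+ k.+2)^-1)).
    apply: ler_sum => k _; rewrite -mulr_suml.
    have b0 : 0 < (block_bound k)%:R :> R by rewrite ltr0n muln_gt0 expn_gt0.
    rewrite ler_pdivrMr ?exprn_gt0//; have [Bu Bs _] := BP g k.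
    apply: le_trans (Lsq _ Bu) _; rewrite mulrC -mulrA ler_wpM2l//.
    rewrite -(ler_nat R) in Bs; apply: le_trans Bs _.
    rewrite ler_pdivlMl ?exprn_gt0// -natrX -!natrM -natrX ler_nat.
    by rewrite /block_size /block_bound expnMn mulnCA -mulnA leqnn.
  rewrite -mulr_sumr ler_wpM2l//.
  have -> n : \sum_(k < n) (2 ^+ k.+2)^-1 = 2^-1 - (2 ^+ n.+1)^-1 :> R.
    elim: n => [|n IH]; first by rewrite big_ord0 expr1 subrr.
    rewrite big_ord_recr/= IH -addrA; congr (_ + _).
    by rewrite [2 ^+ n.+2]exprS invfM; lra.
  by rewrite gerBl invr_ge0 exprn_ge0.
rewrite sumrB big_const_seq count_predT iter_addr_0; lra.
Qed.

Let upd g (e : R) s : G -> R :=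
  fun x => if x == g then (good g s)%:R * e else s x.

Let sumE g e s C : uniq C -> \sum_(x <- C) upd g e s x =
  (g \in C)%:R * ((good g s)%:R * e) + \sum_(x <- rem g C) s x.
Proof.
move=> uC.
have out D : g \notin D -> \sum_(x <- D) upd g e s x = \sum_(x <- D) s x.
  move=> gD; apply: eq_big_seq => x xD; rewrite /upd ifN//.
  by apply: contra gD => /eqP <-.
have [gC|gC] := boolP (g \in C); last by rewrite mul0r add0r rem_id// out.
rewrite (big_rem g)//= {1}/upd eqxx mul1r out//.
by rewrite rem_filter// mem_filter /= eqxx.
Qed.

(** Indices are added in increasing order: for the new largest [g], every sample point is doubled,
    with value 1 or -1 at [g] if its constraints at [g] hold and 0 in both copies otherwise. *)
Lemma sample_exists F : exists L,
  [/\ (0 < size L)%N, (forall s, s \in L -> admissible s)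
    & forall g, g \in F -> (size L)%:R <= 2 * \sum_(s <- L) `|s g|].
Proof.
pose le x y := (x == y) || lt y x.
suff main (D : seq G) : uniq D -> pairwise le D -> exists L, sample D L.
  have [||L [L0 La _ _ Lg]] := main (sort le (undup F)).
  - by rewrite sort_uniq undup_uniq.
  - rewrite -sorted_pairwise ?sort_sorted// => [x y|y x z].
      by rewrite /le; have [//|/ltot] := eqVneq x y; rewrite orbC.
    rewrite /le => /orP[/eqP->//|yx] /orP[/eqP<-|zy]; first by rewrite yx orbT.
    by rewrite (ltt zy yx) orbT.
  exists L; split=> // g gF; apply: Lg; by rewrite mem_sort mem_undup.
elim: D => [_ _|g D IH /= /andP[gD uD] /andP[/allP gleD pD]].
  exists [:: (fun=> 0)]; split=> //.
  - by move=> s; rewrite inE => /eqP->; split=> [x|x]; [left|rewrite eqxx].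
  - by move=> s; rewrite inE => /eqP->.
  - by move=> C _; rewrite big_seq1 big1// expr0n/= mulr1.
have [L sL] := IH uD pD; have hL := half_good g sL.
case: sL => L0 Ladm Lsupp Lsq Lg.
have ltD x : x \in D -> lt x g.
  by move=> xD; have /orP[/eqP gx|//] := gleD x xD; rewrite gx xD in gD.
exists ([seq upd g 1 s | s <- L] ++ [seq upd g (-1) s | s <- L]).
have inL' s : s \in [seq upd g 1 s | s <- L] ++ [seq upd g (-1) s | s <- L] ->
    exists2 t, t \in L & exists2 e, `|e| = 1 & s = upd g e t.
  by rewrite mem_cat => /orP[] /mapP[t tL ->]; exists t => //;
     [exists 1|exists (-1)]; rewrite ?normrN ?normr1.
have sizeL' : (size ([seq upd g 1 s | s <- L] ++ [seq upd g (-1) s | s <- L]))%:R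
    = (size L)%:R + (size L)%:R :> R by rewrite size_cat !size_map natrD.
split.
- by rewrite size_cat size_map addn_gt0 L0.
- move=> _ /inL'[s sL [e e1 ->]]; have [s1 s2] := Ladm s sL; split=> [x|h uh k].
    rewrite /upd; case: (eqVneq x g) => // _.
    by case: good; [right; rewrite mul1r|left; rewrite mul0r].
  have [Bu _ Blt] := BP h k.
  (* Blocks of [h] contain only indices below [h], so the largest index [g] is in no relevant block
     and the block sums of [s] are unchanged. *)
  have [gh bh] : g \notin B h k /\ bounded_block s h k.
    move: uh; rewrite /upd; case: (eqVneq h g) => [-> uh|_ sh].
      split; first by apply/negP => /((let: And3 _ _ c := BP g k in c) _); rewrite lti.
      by move: uh; rewrite /good; case: asboolP => // _; rewrite mul0r eqxx.
    split; last exact: s2.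
    apply/negP => /Blt gh; have hD : h \in D.
      by apply: contraNT sh => hD; rewrite (Lsupp s).
    by have := ltt gh (ltD h hD); rewrite lti.
  by rewrite /bounded_block sumE// (negbTE gh) mul0r add0r rem_id.
- move=> _ /inL'[s sL [e e1 ->]] x; rewrite inE negb_or => /andP[xg xD].
  by rewrite /upd (negbTE xg) (Lsupp s).
- move=> C uC; rewrite sizeL' big_cat/= !big_map -big_split/=.
  have [gC|gC] := boolP (g \in C).
    (* The two opposite signs cancel the cross term in the squares. *)
    apply: (@le_trans _ _ (\sum_(s <- L) ((\sum_(x <- rem g C) s x) ^+ 2 + 1) * 2)).
      apply: ler_sum => s _; rewrite !sumE// gC !mul1r; set t := \sum_(x <- _) s x.
      by case: good; rewrite ?mul0r ?mul1r; nra.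
    rewrite -mulr_suml big_split/= big_const_seq count_predT iter_addr_0.
    have := Lsq (rem g C) (rem_uniq g uC).
    have -> : (size C)%:R = (size (rem g C))%:R + 1 :> R.
      by rewrite size_rem// natr1 prednK//; case: (C) gC.
    lra.
  have := Lsq C uC; under eq_bigr do rewrite !sumE// (negbTE gC) !mul0r !add0r rem_id//.
  rewrite big_split/=; lra.
- move=> x; rewrite sizeL' big_cat/= !big_map -big_split/= inE.
  have [->|xg] := eqVneq x g => /=.
    move=> _; under eq_bigr do rewrite /upd eqxx !normrM normrN normr1 mulr1 normr_nat.
    by rewrite big_split/=; lra.
  move=> /Lg; under [in X in _ -> X]eq_bigr do rewrite /upd (negbTE xg).
  by rewrite big_split/=; lra.
Qed.

End FiniteSamples.

(** * Closed spans *)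

Section ClosedSpan.
Context {R : realType} {V : completeNormedModType R} {I : Type}.
Variable e : I -> V.

(** As an intersection of closed subspaces, the span comes with its induction principle. *)
Definition closed_span_pred : {pred V} := fun v =>
  `[< forall S : set V, closed S -> S 0 ->
      (forall a u w, S u -> S w -> S (a *: u + w)) -> (forall i, S (e i)) -> S v >].

Fact closed_span_submod_closed : submod_closed closed_span_pred.
Proof.
split; first by apply/asboolP.
move=> a u v /asboolP hu /asboolP hv; apply/asboolP => S cS S0 SD Se.
by apply: (SD); [exact: hu|exact: hv].
Qed.

HB.instance Definition _ := GRing.isSubmodClosed.Build R V
  closed_span_pred closed_span_submod_closed.

Definition closed_span := subnormed closed_span_pred.

HB.instance Definition _ := NormedModule.on closed_span.

Fact closed_span_closed : closed [set v | v \in closed_span_pred].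
Proof.
rewrite (_ : [set _ | _] = \bigcap_(S in [set S : set V | [/\ closed S, S 0,
    (forall a u w, S u -> S w -> S (a *: u + w)) & forall i, S (e i)]]) S).
  by apply: closed_bigI => S [].
apply/seteqP; split => v.
  by move=> /asboolP h S [*]; exact: h.
by move=> h; apply/asboolP => S *; exact: h.
Qed.

HB.instance Definition _ := Uniform_isComplete.Build closed_span
  (subnormed_complete closed_span_closed).

Fact span_gen_subproof i : e i \in closed_span_pred.
Proof. exact/asboolP. Qed.

Definition span_gen i : closed_span := SubNormed (span_gen_subproof i).

(** The kernel of [f], seen in [V], is a closed subspace containing the generators; it is closed in
    [V] because the span is closed and [f] is bounded. *)
Lemma closed_span_dual0 (f : dual closed_span) :
  (forall i, f (span_gen i) = 0) -> f = 0.
Proof.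
move=> fe; apply: val_inj; apply/funext => -[v vS]; have /asboolP := vS.
move=> /(_ [set u | exists2 x : closed_span, val x = u & f x = 0]) h.
suff [x xv fx] : exists2 x : closed_span, val x = v & f x = 0.
  by rewrite -[RHS]fx; congr (dual_val f _); exact: val_inj.
apply: h => [u|||].
- move=> clu.
  have uS : u \in closed_span_pred.
    apply: closed_span_closed; move=> W /clu[_ [[x <- _] Wx]].
    by exists (val x); split => //=; exact: valP.
  exists (SubNormed uS) => //; apply/eqP; rewrite -normr_le0 leNgt; apply/negP => fu.
  have d0 : 0 < `|f (SubNormed uS)| / (`|f| + 1) by rewrite divr_gt0// ltr_wpDl.
  have [_ [[x <- fx]]] := clu _ (nbhsx_ballx u _ d0).
  rewrite -ball_normE/= => xu.
  have : `|f (SubNormed uS)| <= `|f| * `|u - val x|.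
    have -> : f (SubNormed uS) = f (SubNormed uS - x) by rewrite linearB/= fx subr0.
    exact: dual_norm_ub.
  have f1 : 0 < `|f| + 1 by rewrite ltr_wpDl.
  move: xu; rewrite ltr_pdivlMr// => xu h'.
  have k : `|f| * `|u - val x| <= `|u - val x| * (`|f| + 1).
    by rewrite mulrC ler_wpM2l// lerDl.
  by have := le_lt_trans (le_trans h' k) xu; rewrite ltxx.
- by exists 0 => //; rewrite linear0.
- move=> a _ _ [x <- fx] [y <- fy]; exists (a *: x + y) => //.
  by rewrite linearP/= fx fy scaler0 addr0.
- by move=> i; exists (span_gen i).
Qed.

End ClosedSpan.

(** * The space *)

Section AdmissibleSpace.
Context {R : realType} {G : pointedType}.
Variable B : G -> nat -> seq G.

Definition admissible_point := {s : G -> R | @admissible R G B s}.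

Lemma admissible_point_le1 (s : admissible_point) g : `|sval s g| <= 1.
Proof. by have [->|->] := (svalP s).1 g; rewrite ?normr0. Qed.

Fact coordinate_subproof g :
  (fun s : admissible_point => sval s g) \in @linf_pred R admissible_point.
Proof. by apply/asboolP; exists 1 => s; exact: admissible_point_le1. Qed.

Definition coordinate g : linf R admissible_point := Linf (coordinate_subproof g).

Local Notation coordinate_space := (@closed_span R (linf R admissible_point) G coordinate).

Let span_val_linear a (x y : coordinate_space) s :
  subnormed_val (a *: x + y) s = a * subnormed_val x s + subnormed_val y s.
Proof.
have -> : subnormed_val (a *: x + y) = a *: subnormed_val x + subnormed_val y.
  exact: (linearP (val : coordinate_space -> linf R admissible_point)).
by [].
Qed.

Definition coord g : coordinate_space := span_gen coordinate g.

Lemma point_eval_exists (s : admissible_point) : exists d : dual_unit_ball coordinate_space,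
  forall x, dual_unit_ball_val d x = subnormed_val x s.
Proof.
have [|x|f [f1 fE]] := @dual_of_bounded R coordinate_space
  (fun x => subnormed_val x s) 1 ler01.
- by move=> a x y; exact: span_val_linear.
- by rewrite mul1r; exact: linf_norm_ub.
- by have [d dE] := dual_ball_of f1; exists d => x; rewrite dE fE.
Qed.

Definition point_eval (s : admissible_point) : dual_unit_ball coordinate_space :=
  sval (cid (point_eval_exists s)).

Lemma point_evalE s (x : coordinate_space) :
  dual_unit_ball_val (point_eval s) x = subnormed_val x s.
Proof. by rewrite /point_eval; case: cid. Qed.

Lemma point_eval_coord s g : dual_unit_ball_val (point_eval s) (coord g) = sval s g.
Proof. by rewrite point_evalE. Qed.

Lemma coordinate_space_norm_le (x : coordinate_space) M : 0 <= M ->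
  (forall s, `|dual_unit_ball_val (point_eval s) x| <= M) -> `|x| <= M.
Proof.
move=> M0 h; apply: linf_norm_le => // s; by rewrite -point_evalE.
Qed.

Lemma coord_norm g : `|coord g| <= 1.
Proof.
by apply: coordinate_space_norm_le => // s; rewrite point_eval_coord admissible_point_le1.
Qed.

Hypothesis Bcap : captures_sequences B.

Let ev s : dual coordinate_space := dual_unit_ball_val (point_eval s).

(** [y] averages the [coord (a i)] over an initial block of an injective sequence in [P], and [P']
    collects the [g] in [P] whose [k]-th constraint controls exactly this block. *)
Let block_average (P : set G) (eps : R) : 0 < eps -> ~ countable P ->
  exists (y : coordinate_space) (P' : set G),
  [/\ P' `<=` P, ~ countable P',
      (forall (f : dual coordinate_space) c, (forall g, P g -> c <= f (coord g)) -> c <= f y),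
      (forall s, ev s y != 0 -> exists2 g, P g & sval s g != 0) /\
    (forall s g, P' g -> sval s g != 0 -> `|ev s y| <= eps) & `|y| <= 1].
Proof.
move=> eps0 Pu.
have /infiniteP/pcard_leP/injfunPex[a aP aI] : infinite_set P.
  by move=> /finite_set_countable.
have {}aI : injective a by move=> i j; apply: aI; rewrite inE.
have [D Dc DP] := Bcap aI.
(* For [k >= K] the ratio [block_bound k / block_size k = 1 / (k + 1)] is at most [eps]. *)
pose K := Num.truncn eps^-1.
(* Off the countable [D], [P] is covered by the countably many [Pk k] with [k >= K], so one of these
   is uncountable. *)
pose Pk k := [set g | P g /\ B g k = [seq a i | i <- iota 0 (block_size k)]].
have [k Kk Pku] : exists2 k, (K <= k)%N & ~ countable (Pk k).
  apply: contrapT => h; apply: Pu.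
  have : P `<=` D `|` \bigcup_(k in [set k | (K <= k)%N]) Pk k.
    move=> g Pg; have [Dg|/DP/(_ K)[k Kk kg]] := pselect (D g); first by left.
    by right; exists k.
  move=> /subset_card_le /sub_countable; apply.
  rewrite -bigcup2E; apply: bigcup_countable => // -[|[|n]] _ //=.
  apply: bigcup_countable => // k /= Kk; apply: contrapT => ku; apply: h.
  by exists k.
have N0 : 0 < (block_size k)%:R :> R by rewrite ltr0n muln_gt0 !expn_gt0.
pose y : coordinate_space :=
  (block_size k)%:R^-1 *: \sum_(i <- iota 0 (block_size k)) coord (a i).
have fy (f : dual coordinate_space) :
    f y = (block_size k)%:R^-1 * \sum_(i <- iota 0 (block_size k)) f (coord (a i)).
  by rewrite /y linearZ/= linear_sum.
exists y, (Pk k); split=> //.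
- by move=> g [].
- move=> f c fc; rewrite fy ler_pdivlMl//.
  apply: (@le_trans _ _ (\sum_(i <- iota 0 (block_size k)) c)).
    by rewrite big_const_seq count_predT iter_addr_0 size_iota mulr_natl.
  by apply: ler_sum => i _; apply: fc; exact: aP.
- split=> s.
  rewrite fy => sy; apply: contrapT => h; move: sy; apply/negP/negPn.
    rewrite big1 ?mulr0// => i _; rewrite point_eval_coord.
    by apply/eqP/negPn/negP => sai; apply: h; exists (a i) => //; exact: aP.
  move=> g [Pg gB] sg; rewrite fy normrM normfV (ger0_norm (ltW N0)) ler_pdivrMl//.
  have := (svalP s).2 g sg k; rewrite /bounded_block gB big_map.
  under [X in _ -> `|X| <= _]eq_bigr do rewrite point_eval_coord.
  move=> /le_trans; apply.
  have : eps^-1 <= k.+1%:R.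
    by apply: le_trans (ltW (truncnS_gt _)) _; rewrite ler_nat ltnS.
  rewrite -[X in X <= _](mulr1) ler_pdivrMl// => ek.
  have -> : block_size k = (block_bound k * k.+1)%N by rewrite /block_size /block_bound expnS expn1 mulnAC.
  by rewrite natrM -mulrA -[leLHS]mulr1 ler_wpM2l// mulrC.
- rewrite /y normrZ normfV (ger0_norm (ltW N0)) ler_pdivrMl// mulr1.
  apply: le_trans (ler_norm_sum _ _ _) _.
  apply: (@le_trans _ _ (\sum_(i <- iota 0 (block_size k)) 1)).
    by apply: ler_sum => i _; exact: coord_norm.
  by rewrite big_const_seq count_predT iter_addr_0 size_iota.
Qed.

(** The averages are taken over nested index sets. Where the later ones sum to 0, only the first
    counts, with value at most 1; elsewhere [s] is non-zero on [P'] and the first contributes at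
    most [eps]. *)
Let block_sum (eps : R) (n : nat) (P : set G) : 0 < eps -> ~ countable P ->
  exists w : coordinate_space,
  [/\ (forall (f : dual coordinate_space) c,
         (forall g, P g -> c <= f (coord g)) -> n%:R * c <= f w),
      (forall s, ev s w != 0 -> exists2 g, P g & sval s g != 0)
    & (forall s, `|ev s w| <= 1 + n%:R * eps)].
Proof.
move=> eps0; elim: n P => [|n IH] P Pu.
  exists 0; split=> [f c _|s|s]; rewrite ?linear0 ?mul0r ?eqxx//.
  by rewrite normr0 addr0.
have [y [P' [P'P P'u yf [ysupp yeps] ynorm]]] := block_average eps0 Pu.
have [w [wf wsupp wle]] := IH P' P'u.
exists (y + w); split.
- move=> f c fc; rewrite linearD/= -natr1 mulrDl mul1r addrC lerD ?yf//.
  by apply: wf => g /P'P; exact: fc.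
- move=> s; have [y0|/ysupp//] := eqVneq (ev s y) 0.
  rewrite linearD/= y0 add0r => /wsupp[g gP' sg]; exists g => //; exact: P'P.
- move=> s; rewrite linearD/=; have [w0|/wsupp[g gP' sg]] := eqVneq (ev s w) 0.
    rewrite w0 addr0 -[leLHS]addr0 lerD ?mulr_ge0 ?(ltW eps0)//.
    by apply: le_trans (dual_ball_le _ _) _; apply: le_trans ynorm _.
  apply: le_trans (ler_normD _ _) _; rewrite -natr1 mulrDl mul1r.
  have := yeps s g gP' sg; have := wle s; lra.
Qed.

Let uncountable_bound (f : dual coordinate_space) (c : R) : 0 < c ->
  countable [set g | c <= f (coord g)].
Proof.
move=> c0; apply: contrapT => Pu.
have f1 : 0 < `|f| + 1 by rewrite ltr_wpDl.
(* With this [eps], [N * c <= f w] is at most [(|f| + 1) + N * c / 2], which fails once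
   [N * c > 2 * (|f| + 1)]. *)
pose eps := c / (2 * (`|f| + 1)).
have eps0 : 0 < eps by rewrite divr_gt0// mulr_gt0.
pose N := (Num.truncn (2 * (`|f| + 1) / c)).+1.
have [w [wf _ wle]] := block_sum N eps0 Pu.
have Nc : 2 * (`|f| + 1) < N%:R * c by rewrite -ltr_pdivrMr// truncnS_gt.
have h1 : N%:R * c <= f w by apply: wf => g.
have h2 : `|w| <= 1 + N%:R * eps.
  by apply: coordinate_space_norm_le => //; rewrite addr_ge0// mulr_ge0// ltW.
have h3 : f w <= `|f| * `|w| by apply: le_trans (ler_norm _) (dual_norm_ub _ _).
have h4 : `|f| * `|w| <= (`|f| + 1) * (1 + N%:R * eps).
  by apply: ler_pM => //; rewrite lerDl.
have h5 : (`|f| + 1) * (1 + N%:R * eps) = (`|f| + 1) + N%:R * c / 2.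
  by rewrite /eps; field; rewrite gt_eqF.
rewrite h5 in h4; lra.
Qed.

Lemma dual_countable_support (f : dual coordinate_space) :
  countable [set g | f (coord g) != 0].
Proof.
pose C (h : dual coordinate_space) := \bigcup_n [set g | n.+1%:R^-1 <= h (coord g)].
have Cc h : countable (C h).
  by apply: bigcup_countable => // n _; apply: uncountable_bound; rewrite invr_gt0.
have : [set g | f (coord g) != 0] `<=` C f `|` C (- f).
  move=> g /=.
  have main (h : dual coordinate_space) : 0 < h (coord g) -> C h g.
    move=> hg; exists (Num.truncn (h (coord g))^-1) => //=.
    by rewrite -[leRHS]invrK lef_pV2 ?posrE ?invr_gt0// ltW// truncnS_gt.
  rewrite neq_lt => /orP[fg|fg]; last by left; exact: main.
  by right; apply: main; rewrite [ltRHS](_ : _ = - f (coord g))// oppr_gt0.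
move=> /subset_card_le /sub_countable; apply.
by rewrite -bigcup2E; apply: bigcup_countable => // -[|[|n]] _ //=.
Qed.

Let coord_fun (f : dual coordinate_space) : G -> R^o := fun g => f (coord g).

Let coord_fun_linf f : coord_fun f \in @linf_pred R G.
Proof.
apply/asboolP; exists `|f| => g; apply: le_trans (dual_norm_ub _ _) _.
rewrite -[leRHS]mulr1; apply: ler_wpM2l; [exact: (normr_ge0 f)|exact: coord_norm].
Qed.

Let coord_linf f : linf R G := Linf (coord_fun_linf f).

Let coord_linf_c f : coord_linf f \in @linf_c_pred R G.
Proof. by apply/asboolP; exact: dual_countable_support. Qed.

Let Phi f : linf_c R G := SubNormed (coord_linf_c f).

Let Phi_linear : linear Phi.
Proof.
move=> a f h; apply: val_inj.
rewrite [RHS](linearP (val : linf_c R G -> linf R G)).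
by apply: val_inj; apply/funext => g.
Qed.

Lemma coordinate_space_wld : weakly_lindelof_determined coordinate_space.
Proof.
pose L : {linear dual coordinate_space -> linf_c R G} :=
  HB.pack Phi (GRing.isLinear.Build R (dual coordinate_space) (linf_c R G) *:%R Phi Phi_linear).
exists G, L; split.
- exact: (inhabits point).
- apply: bounded_linear_continuous; apply/linear_boundedP; exists 1; split=> // M M1 f.
  apply: linf_norm_le => [|g]; first by rewrite mulr_ge0// (le_trans ler01)// ltW.
  apply: le_trans (dual_norm_ub _ _) _; rewrite mulrC.
  apply: ler_pM; [exact: normr_ge0|exact: (normr_ge0 f)| |exact: lexx].
  exact: le_trans (coord_norm g) (ltW M1).
- move=> f h fh; apply/eqP; rewrite -subr_eq0; apply/eqP.
  apply: closed_span_dual0 => g.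
  rewrite [LHS](_ : _ = f (coord g) - h (coord g))//.
  have := congr1 (fun z : linf_c R G => subnormed_val z g) fh.
  by rewrite /= /coord_linf /= /coord_fun => ->; rewrite subrr.
- move=> f; pose F := (fun h : weakstar coordinate_space =>
    (subnormed_val (L h) : {ptws G -> R})) @ (f : weakstar coordinate_space).
  have FN : Filter (nbhs (f : weakstar coordinate_space)) by exact: nbhs_filter.
  have FF : Filter F by exact: fmap_filter.
  have := @cvg_ptws G R F (subnormed_val (L f)) FF; apply => g.
  have h2 : (fun h : dual coordinate_space => (h : {ptws coordinate_space -> R})) @
      (f : weakstar coordinate_space) --> (f : {ptws coordinate_space -> R}).
    exact: (@initial_continuous (dual coordinate_space) {ptws coordinate_space -> R}
      (fun h : dual coordinate_space => (h : {ptws coordinate_space -> R})) f).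
  exact: (cvg_comp _ _ h2 (@ptws_eval_continuous coordinate_space R (coord g) f)).
Qed.

End AdmissibleSpace.

(** * The mean and the tensor product *)

Section Mean.
Context {R : realType} {G : pointedType} {lt : rel G} {B : G -> nat -> seq G}.
Hypotheses (lti : irreflexive lt) (ltt : transitive lt).
Hypothesis ltot : forall x y, x != y -> lt x y || lt y x.
Hypothesis BP : block_family lt B.
Local Notation T := (@admissible_point R G B).

Let sample_points (F : seq G) : exists L : seq T, (0 < size L)%N /\
  forall g, g \in F -> (size L)%:R <= 2 * \sum_(s <- L) `|sval s g|.
Proof.
have [L [L0 La Lg]] := @sample_exists R G lt B lti ltt ltot BP F.
have [L' L'E] : exists L' : seq T, map sval L' = L.
  elim: L La {L0 Lg} => [|s L IH] La; first by exists [::].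
  have [|L' <-] := IH; first by move=> t tL; apply: La; rewrite inE tL orbT.
  have sa : admissible (B := B) s by apply: La; rewrite inE eqxx.
  by exists (exist _ s sa :: L').
exists L'; rewrite -(size_map sval) L'E; split=> // g gF.
by apply: le_trans (Lg g gF) _; rewrite -L'E big_map.
Qed.

Fact abs_coordinate_subproof g :
  (fun s : T => `|sval s g|) \in @linf_pred R T.
Proof. by apply/asboolP; exists 1 => s; rewrite normr_id; exact: admissible_point_le1. Qed.

Definition abs_coordinate g : linf R T := Linf (abs_coordinate_subproof g).

Let supT (h : linf R T) : R := sup (range (fun s => h s : R)).

Let le_supT (h : linf R T) s : h s <= supT h.
Proof.
apply: ub_le_sup; last by exists s.
by exists `|h| => _ [t _ <-]; apply: le_trans (ler_norm _) _; exact: linf_norm_ub.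
Qed.

Let supT_le (h : linf R T) c : (forall s, h s <= c) -> supT h <= c.
Proof.
move=> hc; apply: ge_sup; last by move=> _ [s _ <-].
(* A sample for no index at all shows that admissible points exist, so the supremum is over a
   non-empty set. *)
by have [[|s L] [L0 _]] := sample_points [::] => //; exists (h s), s.
Qed.

(** Hahn-Banach below the supremum. The demands are the lower bounds valid for the averages over all
    samples good for some finite [F]; they add up by concatenating the lists [F], and a sample for
    [F] shows that they do not exceed the supremum. *)
Lemma mean_exists : exists M : linf R T -> R^o,
  [/\ linear M, (forall (h : linf R T) c, (forall s, h s <= c) -> M h <= c)
    & forall g, 1 / 2 <= M (abs_coordinate g)].
Proof.
have sp : sublinear supT.
  split=> [h k|t h t0].
    by apply: supT_le => s; apply: lerD; exact: le_supT.
  by apply: supT_le => s; rewrite [leLHS](_ : _ = t * h s)// ler_pM2l// le_supT.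
pose K := [set u : linf R T * R | exists F : seq G, forall L : seq T,
  (0 < size L)%N -> (forall g, g \in F -> (size L)%:R <= 2 * \sum_(s <- L) `|sval s g|) ->
  u.2 * (size L)%:R <= \sum_(s <- L) u.1 s].
have cK : cone K.
  split=> [|[h r] [k q] [F hF] [E kE]|t [h r] t0 [F hF]] /=.
  - by exists [::] => L _ _; rewrite mul0r sumr_ge0.
  - exists (F ++ E) => L L0 LFE /=; rewrite mulrDl.
    rewrite [leRHS](_ : _ = \sum_(s <- L) h s + \sum_(s <- L) k s); last by rewrite -big_split.
    by apply: lerD; [apply: hF|apply: kE] => // g gF; apply: LFE; rewrite mem_cat gF ?orbT.
  - exists F => L L0 LF /=; rewrite -mulrA.
    rewrite [leRHS](_ : _ = t * \sum_(s <- L) h s); last by rewrite mulr_sumr.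
    by rewrite ler_pM2l//; exact: hF.
have pK h r : K (h, r) -> r <= supT h.
  move=> [F hF]; have [L [L0 LF]] := sample_points F.
  have n0 : 0 < (size L)%:R :> R by rewrite ltr0n.
  rewrite -(ler_pM2r n0); apply: le_trans (hF L L0 LF) _ => /=.
  apply: (@le_trans _ _ (\sum_(s <- L) supT h)); first by apply: ler_sum => s _; exact: le_supT.
  by rewrite big_const_seq count_predT iter_addr_0 mulr_natr.
have [M [Ml Mp MK]] := hahn_banach_cone sp cK pK.
exists M; split=> // [h c hc|g]; first by apply: le_trans (Mp h) (supT_le hc).
apply: MK; exists [:: g] => L L0 /(_ g) /=; rewrite inE eqxx => /(_ isT); lra.
Qed.

End Mean.

(** * Failure of property (C) in the injective tensor square *)

Section TensorFailsC.
Context {R : realType} {G : pointedType} {B : G -> nat -> seq G}.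
Local Notation T := (@admissible_point R G B).
Local Notation X := (closed_span (@coordinate R G B)).
Local Notation XX := (injective_tensor X X : completeNormedModType R).
Local Notation ball := (dual_unit_ball X).
Hypothesis Bcap : captures_sequences B.
Hypothesis Gu : ~ countable [set: G].
Variable M : linf R T -> R^o.
Hypothesis Ml : linear M.
Hypothesis Mle : forall (h : linf R T) c, (forall s, h s <= c) -> M h <= c.
Hypothesis M12 : forall g, 1 / 2 <= M (abs_coordinate g).

Fact diagonal_subproof (u : linf R (ball * ball)) :
  (fun s : T => u (point_eval s, point_eval s)) \in @linf_pred R T.
Proof. by apply/asboolP; exists `|u| => s; exact: linf_norm_ub. Qed.

Let diagonal u : linf R T := Linf (diagonal_subproof u).

Let MN h : M (- h) = - M h.
Proof.
by have := Ml (-1) h 0; rewrite addr0 scaleN1r => ->; rewrite scaleN1r (_ : M 0 = 0) ?addr0//;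
   have := Ml (-1) 0 0; rewrite scaler0 addr0 scaleN1r addNr.
Qed.

Let diagonal_mean_exists : exists tau : dual XX, `|tau| <= 1 /\
  forall z, tau z = M (diagonal (subnormed_val z)).
Proof.
apply: dual_of_bounded => // [a x y|z].
  rewrite -Ml; congr M; apply: val_inj; apply/funext => s.
  have e : subnormed_val (a *: x + y) = a *: subnormed_val x + subnormed_val y.
    exact: (linearP (val : injective_tensor X X -> linf R (ball * ball))).
  exact: (congr1 (fun u : linf R (ball * ball) => u (point_eval s, point_eval s)) e).
have zle s : `|subnormed_val z (point_eval s, point_eval s)| <= `|z|.
  exact: (linf_norm_ub (subnormed_val z) (point_eval s, point_eval s)).
rewrite mul1r ler_norml; apply/andP; split.
  rewrite lerNl -MN; apply: Mle => s; apply: le_trans (ler_norm _) _.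
  by rewrite [X in `|X|](_ : _ = - (subnormed_val z (point_eval s, point_eval s)))// normrN.
by apply: Mle => s; apply: le_trans (ler_norm _) _; exact: zle.
Qed.

Let tensor_eval_exists (p : ball * ball) : exists d : dual XX,
  forall z, d z = subnormed_val z p.
Proof.
have [|x|f [_ fE]] := @dual_of_bounded R XX (fun z => subnormed_val z p) 1 ler01.
- move=> a x y.
  have e : subnormed_val (a *: x + y) = a *: subnormed_val x + subnormed_val y.
    exact: (linearP (val : injective_tensor X X -> linf R (ball * ball))).
  exact: (congr1 (fun u : linf R (ball * ball) => u p) e).
- by rewrite mul1r; exact: (linf_norm_ub (subnormed_val x) p).
- by exists f.
Qed.

Let tensor_elt_subproof g : tensor (coord B g) (coord B g) \in @injective_tensor_pred R X X.
Proof.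
apply/asboolP/subset_closure; exists 1%N, (fun=> coord B g), (fun=> coord B g).
by rewrite big_ord1.
Qed.

Let tensor_elt g : XX := SubNormed (tensor_elt_subproof g).

(** A point of all [C p] has norm at most 1/4, yet [tau], of norm at most 1, is at least 1/2 there.
    A countable subfamily contains [tensor_elt g] for any [g] outside the supports of the first
    components. *)
Lemma injective_tensor_not_corson_C : ~ corson_property_C XX.
Proof.
have [tau [tau1 tauE]] := diagonal_mean_exists.
have [d dE] := choice tensor_eval_exists.
pose C p := [set z : XX | 1 / 2 <= tau z /\ `|d p z| <= 1 / 4].
move=> /(_ (range C))[].
- move=> _ [p _ <-]; split.
    move=> x y t /set_mem[x1 x2] /set_mem[y1 y2]; apply/mem_set.
    have t0 : 0 <= t%:num by [].
    have t1 : 0 <= 1 - t%:num by rewrite subr_ge0.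
    have lin (f : dual XX) : f (t%:num *: x + (1 - t%:num) *: y) = t%:num * f x + (1 - t%:num) * f y.
      by rewrite linearD/= !linearZ.
    rewrite [X in C p X](_ : _ = t%:num *: x + (1 - t%:num) *: y)//; split; rewrite lin.
      by have := ler_wpM2l t0 x1; have := ler_wpM2l t1 y1; lra.
    apply: le_trans (ler_normD _ _) _; rewrite !normrM (ger0_norm t0) (ger0_norm t1).
    by have := ler_wpM2l t0 x2; have := ler_wpM2l t1 y2; lra.
  rewrite (_ : C p = (tau @^-1` [set r | 1 / 2 <= r]) `&`
     ((fun z => `|d p z|) @^-1` [set r | r <= 1 / 4]))//.
  apply: closedI; apply: closed_comp.
  + by move=> z _; exact: dual_continuous.
  + exact: closed_ge.
  + by move=> z _; apply: continuous_comp; [exact: dual_continuous|exact: norm_continuous].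
  + exact: closed_le.
- apply/seteqP; split => // z zC.
  have z4 : `|z| <= 1 / 4.
    apply: linf_norm_le => // p; have [_] : C p z by apply: zC; exists p.
    by rewrite dE.
  have [z2 _] : C (point, point) z by apply: zC; exists (point, point).
  have : tau z <= `|tau| * `|z| by apply: le_trans (ler_norm _) (dual_norm_ub _ _).
  have := ler_wpM2r (normr_ge0 z) tau1; rewrite mul1r; lra.
move=> F [FC Fc F0].
have [q qP] : exists q : set XX -> ball * ball, forall D, F D -> D = C (q D).
  have : forall D, exists q, F D -> D = C q.
    move=> D; have [/FC[q _ <-]|] := pselect (F D); first by exists q.
    by exists (point, point).
  by move=> /choice[q qP]; exists q.
pose supp (f : ball) := [set g | dual_unit_ball_val f (coord B g) != 0].
pose N := \bigcup_(D in F) (supp (q D).1).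
have Nc : countable N.
  by apply: bigcup_countable => // D _; exact: dual_countable_support.
have [g gN] : exists g, ~ N g.
  apply: contrapT => /forallNP h; apply: Gu; apply: sub_countable Nc.
  by apply: subset_card_le => g _; apply: contrapT; exact: h.
suff : set0 (tensor_elt g) by [].
rewrite -F0 => D FD; rewrite (qP D FD); split.
  (* As [s g] is 0 or of modulus 1, its square is its absolute value, so [tau (tensor_elt g) = M
     (abs_coordinate g)]. *)
  apply: le_trans (M12 g) _; rewrite tauE le_eqVlt; apply/orP; left; apply/eqP; congr M.
  apply: val_inj; apply/funext => s.
  rewrite [RHS](_ : _ = dual_unit_ball_val (point_eval s) (coord B g) *
    dual_unit_ball_val (point_eval s) (coord B g))// !point_eval_coord.
  rewrite [LHS](_ : _ = `|sval s g|)//.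
  have [->|s1] := (svalP s).1 g; first by rewrite normr0 mul0r.
  by rewrite -expr2 -real_normK ?num_real// s1 expr1n.
rewrite dE [X in `|X|](_ : _ = dual_unit_ball_val (q D).1 (coord B g) *
  dual_unit_ball_val (q D).2 (coord B g))//.
suff -> : dual_unit_ball_val (q D).1 (coord B g) = 0 by rewrite mul0r normr0.
by apply/eqP/negPn/negP => h; apply: gN; exists D.
Qed.

End TensorFailsC.

(** * Regular extension of finitely additive set functions *)

Section RegularExtension.
Context {R : realType} {K : ptopologicalType}.
Hypotheses (Kh : hausdorff_space K) (Kc : compact [set: K]).
Variable m : set K -> R.
Hypothesis m0 : m set0 = 0.
Hypothesis mT : m setT = 1.
Hypothesis mS : forall A C : set K, A `<=` C -> m A <= m C.
Hypothesis mU : forall A C : set K, m (A `|` C) <= m A + m C.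
Hypothesis mD : forall A C : set K, A `&` C = set0 -> m A + m C <= m (A `|` C).

(** Inner content, used on open sets; the measure is then defined by outer approximation, and it
    dominates [m] on closed sets rather than extending it exactly. *)
Let inner (U : set K) : R := sup [set m C | C in [set C | closed C /\ C `<=` U]].

Let le_inner U C : closed C -> C `<=` U -> m C <= inner U.
Proof.
move=> cC CU; apply: ub_le_sup; last by exists C.
by exists (m setT) => _ [D _ <-]; exact: mS.
Qed.

Let inner_le U c : (forall C, closed C -> C `<=` U -> m C <= c) -> inner U <= c.
Proof.
move=> h; apply: ge_sup; first by exists (m set0), set0 => //; split; [exact: closed0|].
by move=> _ [C [cC CU] <-]; exact: h.
Qed.

Let inner_ge0 U : 0 <= inner U.
Proof. by rewrite -m0; apply: le_inner => //; exact: closed0. Qed.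

Let innerS U V : U `<=` V -> inner U <= inner V.
Proof. by move=> UV; apply: inner_le => C cC CU; apply: le_inner => // x /CU /UV. Qed.

(** Normality separates the parts of [C] outside [U] and outside [V] by disjoint open sets; removing
    each of these from [C] writes [C] as a union of closed subsets of [U] and of [V]. *)
Let innerU U V : open U -> open V -> inner (U `|` V) <= inner U + inner V.
Proof.
move=> oU oV; apply: inner_le => C cC CUV.
have /(@normal_openP R) nK := compact_normal Kh Kc.
have [|||P [Q [oP oQ CUP CVQ PQ0]]] := nK (C `&` ~` U) (C `&` ~` V).
- by apply: closedI => //; exact: open_closedC.
- by apply: closedI => //; exact: open_closedC.
- apply/seteqP; split => // x [[Cx nU] [_ nV]].
  by have [] := CUV _ Cx.
have -> : C = (C `&` ~` P) `|` (C `&` ~` Q).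
  apply/seteqP; split => [x Cx|x [[]|[]]//].
  have [Px|] := pselect (P x); last by left.
  right; split=> // Qx; have : set0 x by rewrite -PQ0.
  by [].
apply: le_trans (mU _ _) _; apply: lerD; apply: le_inner.
- by apply: closedI => //; exact: open_closedC.
- by move=> x [Cx nP]; apply: contrapT => nU; apply: nP; exact: CUP.
- by apply: closedI => //; exact: open_closedC.
- by move=> x [Cx nQ]; apply: contrapT => nV; apply: nQ; exact: CVQ.
Qed.

(** A closed subset of the union is compact, hence covered by finitely many [U n]. *)
Let inner_bigcup (U : nat -> set K) : (forall n, open (U n)) ->
  ((inner (\bigcup_n U n))%:E <= \sum_(n <oo) (inner (U n))%:E)%E.
Proof.
move=> oU.
have fin n : inner (\bigcup_(i in [set i | (i < n)%N]) U i) <= \sum_(i < n) inner (U i).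
  elim: n => [|n IH].
    rewrite big_ord0; apply: inner_le => C _ CU; rewrite -m0; apply: mS => x /CU.
    by move=> [].
  rewrite big_ord_recr/=; apply: le_trans (lerD IH (lexx _)).
  apply: le_trans (innerU _ (oU n)); last by apply: bigcup_open => i _.
  apply: innerS => x [i /= + Ux]; rewrite ltnS leq_eqVlt => /orP[/eqP <-|ilt]; first by right.
  by left; exists i.
set S := (\sum_(n <oo) _)%E.
have S_ge n : ((\sum_(i < n) inner (U i))%:E <= S)%E.
  rewrite -sumEFin -(big_mkord xpredT (fun i => (inner (U i))%:E)).
  by apply: nneseries_lim_ge => i _ _; rewrite lee_fin.
have : (0 <= S)%E by apply: nneseries_ge0 => n _ _; rewrite lee_fin.
case SE : S => [r| |] // r0; last by rewrite leey.
rewrite lee_fin; apply: inner_le => C cC CU.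
have : compact C by apply: (subclosed_compact cC Kc).
rewrite compact_cover => /(_ _ [set: nat] U (fun i _ => oU i) CU)[D _ CD].
pose n := (\max_(i <- finmap.enum_fset D) i).+1.
rewrite -lee_fin -SE; apply: le_trans (S_ge n); rewrite lee_fin.
apply: le_trans (fin n); apply: le_inner => // x /CD[i iD Ux].
exists i => //=; rewrite ltnS; exact: (@leq_bigmax_seq _ _ xpredT id).
Qed.

Let ext (A : set K) : R := inf [set inner U | U in [set U | open U /\ A `<=` U]].

Definition outer_regular_ext (A : set K) : \bar R := (ext A)%:E.

Let ext_le A U : open U -> A `<=` U -> ext A <= inner U.
Proof.
move=> oU AU; apply: ge_inf; last by exists U.
by exists 0 => _ [V _ <-].
Qed.

Let le_ext A c : (forall U, open U -> A `<=` U -> c <= inner U) -> c <= ext A.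
Proof.
move=> h; apply: lb_le_inf; first by exists (inner setT), setT => //; split; [exact: openT|].
by move=> _ [U [oU AU] <-]; exact: h.
Qed.

Let ext_adherent A e : 0 < e -> exists U, [/\ open U, A `<=` U & inner U <= ext A + e].
Proof.
move=> e0; apply: contrapT => h.
have : ext A + e <= ext A.
  apply: le_ext => U oU AU; rewrite leNgt; apply/negP => /ltW k.
  by apply: h; exists U.
by rewrite gerDl leNgt e0.
Qed.

Let outer0 : outer_regular_ext set0 = 0%E.
Proof.
rewrite /outer_regular_ext; congr (_%:E); apply/eqP; rewrite eq_le; apply/andP; split.
  apply: le_trans (ext_le open0 (@subset_refl _ set0)) _; apply: inner_le => C _.
  by rewrite subset0 => ->; rewrite m0.
exact: le_ext.
Qed.

Let outer_ge0 A : (0 <= outer_regular_ext A)%E.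
Proof. by rewrite lee_fin; exact: le_ext. Qed.

Let outerS : {homo outer_regular_ext : A C / A `<=` C >-> (A <= C)%E}.
Proof. by move=> A C AC; rewrite lee_fin; apply: le_ext => U oU CU; apply: ext_le => // x /AC /CU. Qed.

Let outer_sigma_subadditive : sigma_subadditive outer_regular_ext.
Proof.
move=> F; apply/lee_addgt0Pr => e e0.
apply: le_trans (epsilon_trick xpredT _ (ltW e0)); last by move=> n; exact: outer_ge0.
have /choice[U UP] n : exists U, [/\ open U, F n `<=` U & inner U <= ext (F n) + e / (2 ^ n.+1)%:R].
  by apply: ext_adherent; rewrite divr_gt0// ltr0n expn_gt0.
have oU n : open (U n) by have [] := UP n.
apply: (@le_trans _ _ (\sum_(n <oo) (inner (U n))%:E)%E).
  apply: le_trans (inner_bigcup oU); rewrite lee_fin; apply: ext_le.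
    by apply: bigcup_open => n _.
  by move=> x [n _ Fx]; exists n => //; have [_ FU _] := UP n; exact: FU.
apply: lee_nneseries => [n _ _|n _]; first by rewrite lee_fin.
by rewrite -EFinD lee_fin; have [] := UP n.
Qed.

HB.instance Definition _ := isOuterMeasure.Build R K outer_regular_ext
  outer0 outer_ge0 outerS outer_sigma_subadditive.

(** For an open [V] containing [A], take a closed [C] inside [V] and [U], then a closed [D] inside
    [V] minus [C]: they are disjoint, and [mD] adds their values inside [V]. *)
Let open_caratheodory U : open U -> outer_regular_ext.-caratheodory U.
Proof.
move=> oU; apply: le_caratheodory_measurable => A.
rewrite -EFinD lee_fin -/(ext _) -/(ext _) -/(ext _); apply: le_ext => V oV AV.
rewrite -lerBrDr; apply: le_trans (ext_le (U := V `&` U) _ _) _.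
- exact: openI.
- by move=> x [/AV Vx Ux].
apply: inner_le => C cC CVU; rewrite lerBrDr addrC -lerBrDr.
apply: le_trans (ext_le (U := V `&` ~` C) _ _) _.
- by apply: openI => //; exact: closed_openC.
- by move=> x [/AV Vx nUx]; split=> // /CVU[].
apply: inner_le => D cD DVC; rewrite lerBrDr addrC.
apply: le_trans (mD _) _.
  by apply/seteqP; split => // x [Cx /DVC[_]].
apply: le_inner; first exact: closedU.
by move=> x [/CVU[]|/DVC[]].
Qed.

Let borel_caratheodory (A : set (borelType K)) :
  measurable A -> outer_regular_ext.-caratheodory A.
Proof.
move=> mA.
pose S : set (set K) :=
  [set A | outer_regular_ext.-cara.-measurable (A : set (caratheodory_type outer_regular_ext))].
have : <<s @open K >> `<=` S.
  apply: smallest_sub; last by move=> U; exact: open_caratheodory.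
  split; first exact: measurable0.
  - by move=> C SC; rewrite setTD; exact: measurableC.
  - by move=> F SF; apply: bigcupT_measurable => n; exact: SF.
by move=> /(_ A mA).
Qed.

Definition regular_ext : set (borelType K) -> \bar R := outer_regular_ext.

Let regular_ext_sigma_additive : semi_sigma_additive regular_ext.
Proof.
move=> F mF tF mUF.
apply: (@caratheodory_measure_sigma_additive R K outer_regular_ext F) => //.
- by move=> n; exact: borel_caratheodory.
- exact: borel_caratheodory.
Qed.

HB.instance Definition _ := isMeasure.Build _ (borelType K) R regular_ext
  outer0 outer_ge0 regular_ext_sigma_additive.

Let regular_extT : regular_ext setT = 1%E.
Proof.
rewrite /regular_ext /outer_regular_ext; congr (_%:E); apply/eqP; rewrite eq_le; apply/andP; split.
  apply: le_trans (ext_le openT (@subset_refl _ setT)) _.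
  by apply: inner_le => C _ CT; rewrite -mT; exact: mS.
apply: le_ext => U oU UT; rewrite -mT; apply: le_inner => //; exact: closedT.
Qed.

HB.instance Definition _ := Measure_isProbability.Build _ _ _ regular_ext regular_extT.

(** Outer regularity is built in; inner regularity follows by passing to complements, closed sets
    being compact. *)
Lemma regular_extension_exists : exists mu : probability (borelType K) R,
  regular_measure mu /\ forall C : set K, closed C -> ((m C)%:E <= mu C)%E.
Proof.
exists regular_ext; split; last first.
  by move=> C cC; rewrite lee_fin; apply: le_ext => U oU CU; exact: le_inner.
move=> A mA.
have extU (U : set K) : open U -> ext U = inner U.
  move=> oU; apply/eqP; rewrite eq_le ext_le//=.
  by apply: le_ext => V oV UV; exact: innerS.
have extC (C : set (borelType K)) : measurable C -> ext (~` C) = 1 - ext C.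
  move=> mC; have := borel_caratheodory mC setT.
  rewrite !setTI [X in X = _]regular_extT => -[h].
  by rewrite h addrAC subrr add0r.
split; apply/eqP; rewrite eq_le; apply/andP; split.
- apply: le_ereal_inf_tmp => _ [U [oU AU] <-]; exact: outerS.
- apply/lee_addgt0Pr => e e0; have [U [oU AU Ue]] := ext_adherent A e0.
  apply: le_trans (ereal_inf_lbound _) _; first by exists U.
  by rewrite lee_fin -/(ext U) extU.
- apply/lee_subgt0Pr => e e0; have [U [oU AU Ue]] := ext_adherent (~` A) e0.
  have mO : measurable (U : set (borelType K)) by apply: sub_sigma_algebra.
  have CA : ~` U `<=` A by move=> x nU; apply: contrapT => /AU.
  apply: le_trans (ereal_sup_ubound _); last first.
    exists (~` U) => //; split=> //.
    by apply: (subclosed_compact _ Kc) => //; exact: open_closedC.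
  rewrite -EFinB lee_fin -/(ext A) -/(ext (~` U)) (extC _ mO) (extU _ oU).
  by move: Ue; rewrite (extC _ mA); lra.
- by apply: ge_ereal_sup => _ [C [cC CA] <-]; exact: outerS.
Qed.

End RegularExtension.

(** * Failure of property (M) *)

Lemma frechet_urysohn_corson_C (R : realType) (Z : completeNormedModType R) :
  frechet_urysohn (dual_unit_ball Z) -> corson_property_C Z.
Proof.
move=> FU F Fcc F0; apply: contrapT => h.
have [|z] := @frechet_urysohn_cap R Z FU F Fcc; last by rewrite F0.
move=> G GF Gc; apply/set0P/negP => /eqP G0; apply: h.
by exists G.
Qed.

Section FailsM.
Context {R : realType} {G : pointedType} {B : G -> nat -> seq G}.
Local Notation T := (@admissible_point R G B).
Local Notation X := (closed_span (@coordinate R G B)).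
Local Notation ball := (dual_unit_ball X).
Hypothesis Bcap : captures_sequences B.
Hypothesis Gu : ~ countable [set: G].
Variable M : linf R T -> R^o.
Hypothesis Ml : linear M.
Hypothesis Mle : forall (h : linf R T) c, (forall s, h s <= c) -> M h <= c.
Hypothesis M12 : forall g, 1 / 2 <= M (abs_coordinate g).

Let M0 : M 0 = 0.
Proof. by have := Ml (-1) 0 0; rewrite scaler0 addr0 scaleN1r addNr. Qed.

Let MD h k : M (h + k) = M h + M k.
Proof. by have := Ml 1 h k; rewrite !scale1r. Qed.

Let Mmono (h k : linf R T) : (forall s, h s <= k s) -> M h <= M k.
Proof.
move=> hk; have -> : h = (h - k) + k by rewrite subrK.
rewrite MD -[leRHS]add0r lerD2r; apply: Mle => s.
by rewrite [leLHS](_ : _ = h s - k s)// subr_le0.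
Qed.

Fact hits_subproof (A : set ball) :
  (fun s : T => `[< A (point_eval s) >]%:R : R) \in @linf_pred R T.
Proof.
by apply/asboolP; exists 1 => s; case: asboolP; rewrite ?normr1 ?normr0.
Qed.

Let hits A : linf R T := Linf (hits_subproof A).
(** The image of the mean under [point_eval]: a finitely additive probability on all subsets of the
    ball. *)
Let m A : R := M (hits A).

Let m_set0 : m set0 = 0.
Proof.
rewrite /m (_ : hits set0 = 0)//; apply: val_inj; apply/funext => s /=.
by case: asboolP.
Qed.

Let mS A C : A `<=` C -> m A <= m C.
Proof.
move=> AC; apply: Mmono => s; rewrite /hits/=.
case: (asboolP (A _)) => [/AC|_]; first by case: asboolP.
by case: asboolP.
Qed.

Let mU A C : m (A `|` C) <= m A + m C.
Proof.
rewrite /m -MD; apply: Mmono => s.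
rewrite [leRHS](_ : _ = `[< A (point_eval s) >]%:R + `[< C (point_eval s) >]%:R)//.
rewrite /hits/=; case: (asboolP ((A `|` C) _)) => [[]|_]; do 2 (case: asboolP => //=);
  rewrite ?addr0 ?add0r//; lra.
Qed.

Let mD A C : A `&` C = set0 -> m A + m C <= m (A `|` C).
Proof.
move=> AC; rewrite /m -MD; apply: Mmono => s.
rewrite [leLHS](_ : _ = `[< A (point_eval s) >]%:R + `[< C (point_eval s) >]%:R)//.
have AC' : A (point_eval s) -> C (point_eval s) -> False.
  by move=> a c; have : set0 (point_eval s) by rewrite -AC.
rewrite /hits/=; case: (asboolP ((A `|` C) _)) => [_|];
  case: (asboolP (A _)); case: (asboolP (C _)) => //=.
- by move=> c /AC'.
- by rewrite addr0.
- by rewrite add0r.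
- by rewrite addr0.
- by move=> c _ []; right.
- by move=> _ a []; left.
- by move=> c _ []; right.
- by rewrite addr0.
Qed.

Let mT : m setT = 1.
Proof.
have hT s : hits setT s = 1 by rewrite /hits/=; case: asboolP.
apply/eqP; rewrite eq_le; apply/andP; split; first by apply: Mle => s; rewrite hT.
have : M (- hits setT) <= -1.
  by apply: Mle => s; rewrite [leLHS](_ : _ = - hits setT s)// hT.
have := MD (hits setT) (- hits setT); rewrite subrr M0 -/(m _); lra.
Qed.

(** For [g] outside the supports of a countable dense subset of the support of [mu], the open set
    [U] misses that support, so its points have null neighbourhoods. Finitely many cover the compact
    [C], although [mu C >= m C >= 1 / 2]. *)
Lemma coordinate_space_not_M : ~ property_M R ball.
Proof.
move=> hM.
have Kc := @dual_ball_compact R X.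
have [mu [mureg mum]] := regular_extension_exists (@dual_ball_hausdorff R X) Kc
  m_set0 mT mS mU mD.
have [D [Dsupp Dc Dd]] := hM mu mureg.
pose supp (f : ball) := [set g | dual_unit_ball_val f (coord B g) != 0].
pose N := \bigcup_(f in D) supp f.
have Nc : countable N.
  by apply: bigcup_countable => // f _; exact: dual_countable_support.
have [g gN] : exists g, ~ N g.
  apply: contrapT => /forallNP h; apply: Gu; apply: sub_countable Nc.
  by apply: subset_card_le => g _; apply: contrapT; exact: h.
have evc : continuous (fun f : ball => dual_unit_ball_val f (coord B g) : R).
  exact: dual_ball_eval_continuous.
pose U := [set f : ball | dual_unit_ball_val f (coord B g) != 0].
have oU : open U.
  apply: (@open_comp _ _ (fun f : ball => dual_unit_ball_val f (coord B g) : R) [set r | r != 0]).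
    by move=> f _; exact: evc.
  exact: open_neq.
have /choice[V VP] : forall f : ball, exists V : set ball, U f -> [/\ open V, V f & mu V = 0%E].
  move=> f; have [Uf|] := pselect (U f); last by exists set0.
  have : ~ measure_support mu f.
    move=> /Dd /(_ U (open_nbhs_nbhs (conj oU Uf)))[h [Dh Uh]].
    by apply: gN; exists h.
  move=> /existsNP[V /not_implyP[oV /not_implyP[Vf muV]]]; exists V => _; split=> //.
  by apply/eqP; rewrite eq_le measure_ge0 andbT leNgt; apply/negP.
pose C := [set f : ball | 1 / 2 <= `|dual_unit_ball_val f (coord B g)|].
have cC : closed C.
  apply: (@closed_comp _ _ (fun f : ball => `|dual_unit_ball_val f (coord B g)| : R) [set r | 1 / 2 <= r]).
    move=> f _; apply: (@continuous_comp _ _ _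
      (fun f : ball => dual_unit_ball_val f (coord B g) : R) (fun r : R => `|r|)).
      exact: evc.
    exact: norm_continuous.
  exact: closed_ge.
have CU : C `<=` U.
  by move=> f Cf; apply/negP => /eqP f0; move: Cf; rewrite /C/= f0 normr0; lra.
have mC : 1 / 2 <= m C.
  (* Since [|s g|] is 0 or 1, the indicator of [C] at [point_eval s] dominates it. *)
  apply: le_trans (M12 g) _; apply: Mmono => s; rewrite /hits/=.
  case: asboolP => [_|]; first exact: admissible_point_le1.
  rewrite /C/= point_eval_coord; have [->|->] := (svalP s).1 g; first by rewrite normr0.
  by move=> []; lra.
have : compact C by apply: (subclosed_compact cC Kc).
rewrite compact_cover => /(_ _ U V)[|f Cf|E EU CE].
- by move=> f /VP[].
- by exists f; [exact: CU|have [] := VP f (CU f Cf)].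
have null (s : seq ball) : {in s, forall f, U f} ->
    open (\bigcup_(f in [set f | f \in s]) V f) /\ mu (\bigcup_(f in [set f | f \in s]) V f) = 0%E.
  elim: s => [|f s IH] sU.
    rewrite (_ : [set f | f \in [::]] = set0) ?bigcup_set0//; first by split; [exact: open0|].
    by apply/seteqP; split.
  have [|oW W0] := IH; first by move=> h hs; apply: sU; rewrite inE hs orbT.
  have [oV _ V0] := VP f (sU f (mem_head _ _)).
  have -> : \bigcup_(h in [set h | h \in f :: s]) V h =
      V f `|` \bigcup_(h in [set h | h \in s]) V h.
    apply/seteqP; split => [x [h /=]|x [Vx|[h hs Vx]]].
    - by rewrite inE => /orP[/eqP->|hs] Vx; [left|right; exists h].
    - by exists f => //=; rewrite mem_head.
    - by exists h => //=; rewrite inE hs orbT.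
  split; first exact: openU.
  apply/eqP; rewrite eq_le measure_ge0 andbT.
  have mV : measurable (V f : set (borelType ball)) by exact: sub_sigma_algebra.
  have mW : measurable (\bigcup_(h in [set h | h \in s]) V h : set (borelType ball)).
    exact: sub_sigma_algebra.
  by apply: le_trans (measureU2 mu mV mW) _; rewrite [X in (X + _)%E]V0 [X in (_ + X)%E]W0 adde0.
have [|oW W0] := null (finmap.enum_fset E).
  by move=> f fE; have := EU f fE; rewrite inE.
have : (mu C <= 0)%E.
  rewrite -W0; apply: le_measure.
  - rewrite inE -(setCK C); apply: (@measurableC _ (borelType ball)).
    by apply: sub_sigma_algebra; exact: closed_openC.
  - by rewrite inE; exact: sub_sigma_algebra.
  - exact: CE.
move=> /(le_trans (mum C cC)); rewrite lee_fin; lra.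
Qed.

End FailsM.

Theorem mainTheorem12 (R : realType) :
  continuum_hypothesis R ->
  (exists X : completeNormedModType R,
     [/\ weakly_lindelof_determined X,
         ~ property_M R (dual_unit_ball X)
       & ~ corson_property_C (injective_tensor X X : completeNormedModType R)])
  /\
  (forall X : completeNormedModType R,
     weakly_lindelof_determined X ->
     ~ property_M R (dual_unit_ball X) ->
     ~ corson_property_C (injective_tensor X X : completeNormedModType R) ->
     frechet_urysohn (dual_unit_ball X) /\
     ~ frechet_urysohn
         (dual_unit_ball (injective_tensor X X : completeNormedModType R))).
Proof.
move=> CH; split; last first.
  move=> X Xwld _ XXC; split; first exact: weakly_lindelof_determined_frechet_urysohn.
  by move=> /frechet_urysohn_corson_C.
(* The index set is [R] itself, under an order with countable initial segments. *)
have [lt [B [[lti ltt ltot _] BP Bcap]]] := continuum_hypothesis_blocks CH.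
have Ru : ~ countable [set: R] := real_uncountable.
have [M [Ml Mle M12]] := @mean_exists R R lt B lti ltt ltot BP.
exists (closed_span (@coordinate R R B)); split.
- exact: coordinate_space_wld.
- exact: (coordinate_space_not_M Bcap Ru Ml Mle M12).
- exact: (injective_tensor_not_corson_C Bcap Ru Ml Mle M12).
Qed.
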